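(* (Dynamic refutational completeness.) The inference system $\mathit{Inf}$ described in the context is dynamically refutationally complete with respect to the redundancy criterion $(\mathit{Red}_I,\mathit{Red}_{Cl})$. That is, let $(N_i)_{i\ge 0}$ be any sequence of clause sets such that both of the following hold. - It is a derivation: $N_i\setminus N_{i+1}\subseteq \mathit{Red}_{Cl}(N_{i+1})$ for all $i$. - It is fair: every inference of $\mathit{Inf}$ with premises in $N_\infty=\bigcup_i\bigcap_{j\ge i}N_j$ belongs to $\bigcup_i \mathit{Red}_I(N_i)$. If $N_0\models\bot$, then $\bot\in N_i$ for some $i$.
   Context: **Logic and clauses.** We work in monomorphic first-order logic with equality. The signature is a finite set of typed function symbols, and the only predicate is $\approx$. A non-equality atom $A$ is encoded as $A\approx\top$. Literals are $s\approx t$ or $s\not\approx t$. Equations are symmetric, and $s\doteq t$ denotes either kind of literal. Clauses are finite multisets of literals, read disjunctively, and $\bot$ is the empty clause. Substitutions are idempotent. $\mathcal{G}(C)=\{C\theta\mid\theta\text{ grounding for }C\}$, and $\mathcal{G}(N)=\bigcup_{C\in N}\mathcal{G}(C)$. $\models$ is standard (Tarski) first-order entailment. **Ordering.** $\succ$ is a simplification ordering: well-founded, total on ground terms, compatible with contexts, and stable under substitution. It is extended to literals by treating $s\approx s'$ as $\{s,s'\}$ and $s\not\approx s'$ as $\{s,s,s',s'\}$ under the multiset extension, and to clauses by the multiset extension. **Selection and eligibility.** A selection function $\mathit{sel}$ maps a clause to a subset of its negative literals. A literal $l$ is $\sigma$-eligible in $C=C'\vee l$ if either $l\in\mathit{sel}(C)$,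 or nothing is selected in $C$ and $l\sigma$ is maximal in $C\sigma$. Strict $\sigma$-eligibility uses strict maximality. ''Eligible'' means $\sigma$ is empty. **The calculus $\mathit{Inf}$.** Let $\mathcal{CS}=t_1\not\approx s_1\vee\dots\vee t_n\not\approx s_n$, and let $s[u]$ denote a term $s$ with a subterm occurrence $u$. (Sup) From $D'\vee f(\bar t_n)\approx t'$ and $C'\vee s[f(\bar s_n)]\doteq s'$, derive $C'\vee D'\vee s[t']\doteq s'\vee\mathcal{CS}$. (VSup) From $D'\vee x\approx t'$ and $C'\vee s[f(\bar s_n)]\doteq s'$, derive $(C'\vee D'\vee s[t']\doteq s')\sigma$, where $\sigma=\{x\mapsto f(\bar s_n)\}$. For Sup, $\sigma$ is empty. Both rules require the following, with $t$ being $f(\bar t_n)$ or $x$: - $t\approx t'$ is strictly $\sigma$-eligible in $D$. - The second literal is strictly $\sigma$-eligible if positive and $\sigma$-eligible if negative, in $C$. - $t\sigma\not\preceq t'\sigma$ and $s[f(\bar s_n)]\sigma\not\preceq s'\sigma$. - $C\sigma\not\preceq D\sigma$. (EqFact) From $C'\vee f(\bar t_n)\approx v'\vee f(\bar s_n)\approx v$, derive $C'\vee v\not\approx v'\vee f(\bar s_n)\approx v\vee\mathcal{CS}$. Conditions: $f(\bar s_n)\approx v$ is eligible, $f(\bar s_n)\not\preceq v$, and $f(\bar t_n)\not\preceq v'$. (VEqFact) From $C'\vee u'\approx v'\vee u\approx v$, where $u$ or $u'$ is a variable and $\sigma=\mathrm{mgu}(u,u')$, derive $(C'\vee v\not\approx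 v'\vee u\approx v)\sigma$. Conditions: $u\approx v$ is $\sigma$-eligible, $u\sigma\not\preceq v\sigma$, and $u'\sigma\not\preceq v'\sigma$. (Decompose) From $C'\vee f(\bar s_n)\not\approx f(\bar t_n)$, where $f(\bar s_n)\neq f(\bar t_n)$, derive $C'\vee\mathcal{CS}$. (Bind) From $C'\vee x\not\approx t$, where $x\notin t$, derive $C'\{x\mapsto t\}$. (ReflDel) From $C'\vee s\not\approx s$, derive $C'$. For Decompose, Bind and ReflDel, the last literal must be $\sigma$-eligible ($\sigma$ is empty except for Bind). **Ground systems.** For a ground selection function $\mathit{gsel}$, $\mathit{GInf}^{\mathit{gsel}}$ is ground superposition with eligibility with respect to $\mathit{gsel}$. (GSup) From $D'\vee t\approx t'$ and $C'\vee s[t]\doteq s'$, derive $C'\vee D'\vee s[t']\doteq s'$. Conditions: $t\approx t'$ is strictly eligible; the second literal is strictly eligible if positive and eligible if negative; $t\succ t'$; $s[t]\succ s'$; $C\succ D$. The maximal premise is $C$. (GEqFact) From $C'\vee u\approx v'\vee u\approx v$, derive $C'\vee v\not\approx v'\vee u\approx v$. Conditions: $u\approx v$ is eligible, $u\succ v$, and $u\succ v'$. (GEqRes) From $C'\vee s\not\approx s$, derive $C'$. Condition: the literal is eligible. **Ground selection functions.** $\mathcal{G}(\mathit{sel})$ is the set of ground selection functions $\mathit{gsel}$ such that for every ground clause $C$ there is $D$ with $C\in\mathcal{G}(D)$ and $\mathit{gsel}$ selects in $C$ the literals corresponding to those selected by $\mathit{sel}$ in $D$. **Grounding of inferences.**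 For $\iota\in\mathit{Inf}$ of the form $C_1,\dots,C_n\vdash E\vee\mathcal{CS}$ ($\mathcal{CS}$ empty for rules without constraints), $\mathcal{G}^{\mathit{gsel}}(\iota)$ is the set of $\iota_g\in\mathit{GInf}^{\mathit{gsel}}$ of the form $C_1\theta,\dots,C_n\theta\vdash E\theta$ for grounding $\theta$. **Redundancy.** - $\mathit{GRed}_{Cl}(N)$, for ground $N$: the ground clauses $C$ entailed by finitely many clauses of $N$, each $\prec C$. - $\mathit{Red}_{Cl}(N)$: the clauses $C$ such that every $D\in\mathcal{G}(C)$ either lies in $\mathit{GRed}_{Cl}(\mathcal{G}(N))$, or there is $C'\in N$ with $D\in\mathcal{G}(C')$ and $C$ strictly subsumed by $C'$ ($C'$ subsumes $C$ but not vice versa). - $\mathit{GRed}^{\mathit{gsel}}_I(N)$: the ground inferences with maximal premise $C$ and conclusion $E$ such that some premise is in $\mathit{GRed}_{Cl}(N)$, or $E$ is entailed by finitely many clauses of $N$, each $\prec C$. - $\mathit{Red}_I(N)$: the $\iota\in\mathit{Inf}$ such that for all $\mathit{gsel}\in\mathcal{G}(\mathit{sel})$ and all $\iota'\in\mathcal{G}^{\mathit{gsel}}(\iota)$, $\iota'\in\mathit{GRed}^{\mathit{gsel}}_I(\mathcal{G}(N))$.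
   Formalization: The formal theorem additionally assumes that every type has at least one ground term; without this the claim fails, e.g. for N_i = {x ≉ x} with x of a type having no ground terms, which is unsatisfiable and vacuously fair but never contains ⊥. *)

(* Defs.v *)
From Stdlib Require List.
From HB Require Import structures.
From mathcomp Require Import all_boot.
From mathcomp Require Import finmap multiset.

Set Implicit Arguments.
Unset Strict Implicit.
Unset Printing Implicit Defensive.

Local Open Scope fset_scope.
Local Open Scope mset_scope.
Local Open Scope nat_scope.

(* Terms are untyped trees together with a typing predicate [wt]; all notions
   below only consider well-typed terms, clauses and substitutions.  Literals
   are a polarity and the unordered pair (two-element multiset) of the two
   sides, so that equations are symmetric up to Leibniz equality. *)

Record signature := Signature {
  ty : choiceType;
  fsym : finType;
  arg_tys : fsym -> seq ty;
  res_ty : fsym -> ty }.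

Section Terms.
Context (S : signature).

Definition var : Type := (ty S * nat)%type.

Inductive term := Var of var | App of fsym S & seq term.

Fixpoint term_encode (t : term) : GenTree.tree (fsym S + var) :=
  match t with
  | Var x => GenTree.Leaf (inr x)
  | App f ts => GenTree.Node 0 (GenTree.Leaf (inl f) :: map term_encode ts)
  end.

Fixpoint term_decode (t : GenTree.tree (fsym S + var)) : option term :=
  match t with
  | GenTree.Leaf (inr x) => Some (Var x)
  | GenTree.Node _ (GenTree.Leaf (inl f) :: us) =>
      Some (App f (pmap term_decode us))
  | _ => None
  end.

Fixpoint term_nested_ind (P : term -> Prop)
    (HV : forall x, P (Var x))
    (HA : forall f ts, List.Forall P ts -> P (App f ts)) (t : term) : P t :=
  match t with
  | Var x => HV x
  | App f ts => HA f ts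
      ((fix go us : List.Forall P us :=
          match us with
          | [::] => List.Forall_nil P
          | u :: us' => List.Forall_cons u (term_nested_ind HV HA u) (go us')
          end) ts)
  end.

Lemma term_encodeK : pcancel term_encode term_decode.
Proof.
elim/term_nested_ind => [x|f ts IH] //=; congr (Some (App f _)).
by elim: IH => //= u us -> _ ->.
Qed.

HB.instance Definition _ := Choice.copy term (pcan_type term_encodeK).

Definition ty_of (t : term) : ty S :=
  match t with Var x => x.1 | App f _ => res_ty f end.

Fixpoint wt (t : term) : bool :=
  match t with
  | Var _ => true
  | App f ts => all wt ts && (map ty_of ts == arg_tys f)
  end.

Fixpoint tvars (t : term) : seq var :=
  match t with
  | Var x => [:: x]
  | App _ ts => flatten (map tvars ts)
  end.

Definition ground_term (t : term) : bool := wt t && nilp (tvars t).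

Inductive ctx := Hole | CApp of fsym S & seq term & ctx & seq term.

Fixpoint plug (K : ctx) (t : term) : term :=
  match K with
  | Hole => t
  | CApp f us K' vs => App f (us ++ plug K' t :: vs)
  end.

Definition subst := var -> term.

Definition wt_subst (sigma : subst) : Prop :=
  forall x, wt (sigma x) /\ ty_of (sigma x) = x.1.

Fixpoint tsubst (sigma : subst) (t : term) : term :=
  match t with
  | Var x => sigma x
  | App f ts => App f (map (tsubst sigma) ts)
  end.

Definition single (x : var) (t : term) : subst :=
  fun y => if y == x then t else Var y.

Definition is_mgu (sigma : subst) (u u' : term) : Prop :=
  [/\ wt_subst sigma,
      forall x, tsubst sigma (sigma x) = sigma x,
      tsubst sigma u = tsubst sigma u'
    & forall tau, wt_subst tau -> tsubst tau u = tsubst tau u' ->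
        exists2 delta, wt_subst delta & forall x, tau x = tsubst delta (sigma x)].

Definition renaming (rho : var -> var) : Prop :=
  injective rho /\ forall x, (rho x).1 = x.1.

Definition ren (rho : var -> var) : subst := fun x => Var (rho x).

End Terms.

Definition mmap (T U : choiceType) (f : T -> U) (A : {mset T}) : {mset U} :=
  seq_mset (map f A).

Notation literal S := (bool * {mset (term S)})%type.
Notation clause S := {mset (literal S)}.
Definition clause_set (S : signature) : Type := clause S -> Prop.

Definition lit (S : signature) (b : bool) (s t : term S) : literal S :=
  (b, [mset s] `+` [mset t]).

Notation "s ≈ t" := (lit true s t) (at level 70).
Notation "s ≉ t" := (lit false s t) (at level 70).

Lemma lit_sym (S : signature) b (s t : term S) : lit b s t = lit b t s.
Proof. by rewrite /lit msetDC. Qed.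

Section Clauses.
Context (S : signature).
Implicit Types (s t : term S) (sigma : subst S).

Definition bot : clause S := mset0.

Definition wf_literal (l : literal S) : Prop :=
  exists s t, [/\ l = lit l.1 s t, wt s, wt t & ty_of s = ty_of t].

Definition wf_clause (C : clause S) : Prop := forall l, l \in C -> wf_literal l.

Definition wf_clause_set (N : clause_set S) : Prop := forall C, N C -> wf_clause C.

Definition cvars (C : clause S) : seq (var S) :=
  flatten [seq flatten [seq tvars t | t <- l.2] | l : literal S <- C].

Definition ground_clause (C : clause S) : Prop := wf_clause C /\ nilp (cvars C).

Definition lsubst sigma (l : literal S) : literal S := (l.1, mmap (tsubst sigma) l.2).
Definition csubst sigma (C : clause S) : clause S := mmap (lsubst sigma) C.

Definition subsumes (C' C : clause S) : Prop :=
  exists2 sigma, wt_subst sigma & csubst sigma C' `<=` C.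
Definition strictly_subsumes (C' C : clause S) : Prop :=
  subsumes C' C /\ ~ subsumes C C'.

Definition G (C : clause S) : clause_set S :=
  fun D => ground_clause D /\ exists2 theta, wt_subst theta & D = csubst theta C.
Definition GN (N : clause_set S) : clause_set S :=
  fun D => exists2 C, N C & G C D.

(* The many-sorted domains are non-empty subsets of a common carrier; the
   values of [fn] on ill-sorted arguments are irrelevant. *)
Record interp := Interp {
  carrier : Type;
  dom : ty S -> carrier -> Prop;
  fn : fsym S -> seq carrier -> carrier;
  dom_nonempty : forall tau, exists a, dom tau a;
  fn_dom : forall f args, List.Forall2 dom (arg_tys f) args ->
    dom (res_ty f) (fn f args) }.

Fixpoint eval (I : interp) (v : var S -> carrier I) (t : term S) : carrier I :=
  match t with
  | Var x => v x
  | App f ts => fn f (map (eval v) ts)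
  end.

Definition holds_lit (I : interp) (v : var S -> carrier I) (l : literal S) : Prop :=
  exists s t, l = lit l.1 s t /\
    (if l.1 then eval v s = eval v t else eval v s <> eval v t).

Definition models (I : interp) (C : clause S) : Prop :=
  forall v : var S -> carrier I, (forall x, dom x.1 (v x)) ->
    exists2 l, l \in C & holds_lit v l.

Definition entails (N : clause_set S) (C : clause S) : Prop :=
  forall I, (forall D, N D -> models I D) -> models I C.

End Clauses.

Record simplification_order (S : signature) (gt : term S -> term S -> Prop) : Prop := {
  so_trans : forall s t u, wt s -> wt t -> wt u -> gt s t -> gt t u -> gt s u;
  so_wf : well_founded (fun s t => [/\ wt s, wt t & gt t s]);
  so_total : forall s t, ground_term s -> ground_term t ->
    [\/ s = t, gt s t | gt t s];
  so_ctx : forall K s t, wt (plug K s) -> wt (plug K t) ->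
    gt s t -> gt (plug K s) (plug K t);
  so_subst : forall sigma s t, wt_subst sigma -> wt s -> wt t ->
    gt s t -> gt (tsubst sigma s) (tsubst sigma t);
  so_subterm : forall K t, K <> Hole S -> wt (plug K t) -> gt (plug K t) t }.

(* The Dershowitz-Manna multiset extension. *)
Definition mulgt (T : choiceType) (gt : T -> T -> Prop) (M N : {mset T}) : Prop :=
  exists X Y : {mset T},
    [/\ X != mset0, X `<=` M, N = (M `\` X) `+` Y
      & forall y, y \in Y -> exists2 x, x \in X & gt x y].

Section Calculus.
Context (S : signature) (gt : term S -> term S -> Prop).

Definition le_of (T : Type) (r : T -> T -> Prop) (x y : T) : Prop := x = y \/ r y x.

Definition lit_mset (l : literal S) : {mset (term S)} :=
  if l.1 then l.2 else l.2 `+` l.2.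
Definition lgt (l l' : literal S) : Prop := mulgt gt (lit_mset l) (lit_mset l').
Definition cgt (C D : clause S) : Prop := mulgt lgt C D.

Definition tle := le_of gt.
Definition lle := le_of lgt.
Definition cle := le_of cgt.

Definition selection := clause S -> {fset (literal S)}.

Definition selection_function_on (P : clause S -> Prop) (sel : selection) : Prop :=
  forall C, P C -> forall l, l \in sel C -> l \in C /\ l.1 = false.

Definition selection_function := selection_function_on (@wf_clause S).

Definition sel_subst (sigma : subst S) (Sel : {fset (literal S)}) :
  {fset (literal S)} := [fset lsubst sigma l | l in Sel].

Definition Gsel (sel gsel : selection) : Prop :=
  selection_function_on (@ground_clause S) gsel /\
  forall C, ground_clause C ->
    exists D theta, [/\ wf_clause D, wt_subst theta, C = csubst theta D
                      & gsel C = sel_subst theta (sel D)].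

Definition maximal (l : literal S) (C : clause S) : Prop :=
  forall l', l' \in C -> ~ lgt l' l.
Definition strictly_maximal (l : literal S) (C : clause S) : Prop :=
  forall l', l' \in C `\ l -> ~ lle l l'.

(* [Sel] is the set of literals selected in [C]. *)
Definition eligible (Sel : {fset (literal S)}) (sigma : subst S)
    (l : literal S) (C : clause S) : Prop :=
  l \in Sel \/ Sel = fset0 /\ maximal (lsubst sigma l) (csubst sigma C).
Definition strictly_eligible (Sel : {fset (literal S)}) (sigma : subst S)
    (l : literal S) (C : clause S) : Prop :=
  l \in Sel \/ Sel = fset0 /\ strictly_maximal (lsubst sigma l) (csubst sigma C).

Definition sup_eligible (Sel : {fset (literal S)}) (sigma : subst S)
    (l : literal S) (C : clause S) : Prop :=
  if l.1 then strictly_eligible Sel sigma l C else eligible Sel sigma l C.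

Definition id_subst : subst S := @Var S.

(* The premises are ordered so that the maximal premise is the last one. *)
Record ginference := GInference { gprems : seq (clause S); gconcl : clause S }.

Definition max_prem (i : ginference) : clause S := last (bot S) (gprems i).

Inductive GInf (gsel : selection) : ginference -> Prop :=
| GSup D' t t' C' K b s' :
    let lD := t ≈ t' in
    let lC := lit b (plug K t) s' in
    let D := D' `+` [mset lD] in
    let C := C' `+` [mset lC] in
    ground_clause D -> ground_clause C ->
    strictly_eligible (gsel D) id_subst lD D ->
    sup_eligible (gsel C) id_subst lC C ->
    gt t t' -> gt (plug K t) s' -> cgt C D ->
    GInf gsel (GInference [:: D; C] (C' `+` D' `+` [mset lit b (plug K t') s']))
| GEqFact C' u v v' :
    let C := C' `+` [mset u ≈ v'] `+` [mset u ≈ v] in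
    ground_clause C ->
    eligible (gsel C) id_subst (u ≈ v) C ->
    gt u v -> gt u v' ->
    GInf gsel (GInference [:: C] (C' `+` [mset v ≉ v'] `+` [mset u ≈ v]))
| GEqRes C' s :
    let C := C' `+` [mset s ≉ s] in
    ground_clause C ->
    eligible (gsel C) id_subst (s ≉ s) C ->
    GInf gsel (GInference [:: C] C').

(* An inference C_1, ..., C_n |- E ∨ CS.  Its premises [prems] are clauses
   as they occur in a clause set; [inst_prems] are the copies, renamed apart
   for the binary rules, on which the rule operates and over whose variables
   [core] (= E) and [constr] (= CS) are written. *)
Record inference := Inference {
  prems : seq (clause S);
  inst_prems : seq (clause S);
  core : clause S;
  constr : clause S }.

Definition concl (i : inference) : clause S := core i `+` constr i.

Definition CS (ts ss : seq (term S)) : clause S :=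
  seq_mset [seq p.1 ≉ p.2 | p <- zip ts ss].

Definition disjoint_vars (C D : clause S) : Prop :=
  forall x, x \in cvars C -> x \notin cvars D.

(* The side conditions common to the two superposition rules, for the copies
   D0 rho1 and C0 rho2 of the premises D0 and C0: the selection is the one of
   D0 and C0, transported along the renamings. *)
Definition sup_side (sel : selection) (sigma : subst S)
    (D0 C0 : clause S) (rho1 rho2 : var S -> var S)
    (t t' : term S) (b : bool) (s s' : term S) : Prop :=
  let D := csubst (ren rho1) D0 in
  let C := csubst (ren rho2) C0 in
  [/\ renaming rho1, renaming rho2 & disjoint_vars D C] /\
  [/\ strictly_eligible (sel_subst (ren rho1) (sel D0)) sigma (t ≈ t') D,
      sup_eligible (sel_subst (ren rho2) (sel C0)) sigma (lit b s s') C,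
      ~ tle (tsubst sigma t) (tsubst sigma t'),
      ~ tle (tsubst sigma s) (tsubst sigma s')
    & ~ cle (csubst sigma C) (csubst sigma D)].

Inductive rule (sel : selection) : inference -> Prop :=
| Sup D0 C0 rho1 rho2 D' C' f ts ss t' K b s' :
    let D := D' `+` [mset App f ts ≈ t'] in
    let C := C' `+` [mset lit b (plug K (App f ss)) s'] in
    csubst (ren rho1) D0 = D -> csubst (ren rho2) C0 = C ->
    sup_side sel id_subst D0 C0 rho1 rho2
      (App f ts) t' b (plug K (App f ss)) s' ->
    rule sel (Inference [:: D0; C0] [:: D; C]
      (C' `+` D' `+` [mset lit b (plug K t') s']) (CS ts ss))
| VSup D0 C0 rho1 rho2 D' C' x f ss t' K b s' :
    let D := D' `+` [mset Var x ≈ t'] in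
    let C := C' `+` [mset lit b (plug K (App f ss)) s'] in
    let sigma := single x (App f ss) in
    x.1 = res_ty f ->
    csubst (ren rho1) D0 = D -> csubst (ren rho2) C0 = C ->
    sup_side sel sigma D0 C0 rho1 rho2
      (Var x) t' b (plug K (App f ss)) s' ->
    rule sel (Inference [:: D0; C0] [:: D; C]
      (csubst sigma (C' `+` D' `+` [mset lit b (plug K t') s'])) mset0)
| EqFact C' f ts ss v v' :
    let C := C' `+` [mset App f ts ≈ v'] `+` [mset App f ss ≈ v] in
    eligible (sel C) id_subst (App f ss ≈ v) C ->
    ~ tle (App f ss) v -> ~ tle (App f ts) v' ->
    rule sel (Inference [:: C] [:: C]
      (C' `+` [mset v ≉ v'] `+` [mset App f ss ≈ v]) (CS ts ss))
| VEqFact C' u u' v v' sigma :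
    let C := C' `+` [mset u' ≈ v'] `+` [mset u ≈ v] in
    (exists x, u = Var x) \/ (exists x, u' = Var x) ->
    is_mgu sigma u u' ->
    eligible (sel C) sigma (u ≈ v) C ->
    ~ tle (tsubst sigma u) (tsubst sigma v) ->
    ~ tle (tsubst sigma u') (tsubst sigma v') ->
    rule sel (Inference [:: C] [:: C]
      (csubst sigma (C' `+` [mset v ≉ v'] `+` [mset u ≈ v])) mset0)
| Decompose C' f ss ts :
    let C := C' `+` [mset App f ss ≉ App f ts] in
    App f ss <> App f ts ->
    eligible (sel C) id_subst (App f ss ≉ App f ts) C ->
    rule sel (Inference [:: C] [:: C] C' (CS ts ss))
| Bind C' x t :
    let C := C' `+` [mset Var x ≉ t] in
    let sigma := single x t in
    x \notin tvars t ->
    eligible (sel C) sigma (Var x ≉ t) C ->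
    rule sel (Inference [:: C] [:: C] (csubst sigma C') mset0)
| ReflDel C' s :
    let C := C' `+` [mset s ≉ s] in
    eligible (sel C) id_subst (s ≉ s) C ->
    rule sel (Inference [:: C] [:: C] C' mset0).

Definition Inf (sel : selection) (i : inference) : Prop :=
  rule sel i /\ forall C, C \in prems i -> wf_clause C.

Definition GI (gsel : selection) (i : inference) (ig : ginference) : Prop :=
  GInf gsel ig /\
  exists theta, [/\ wt_subst theta,
                    gprems ig = map (csubst theta) (inst_prems i)
                  & gconcl ig = csubst theta (core i)].

Definition entailed_below (N : clause_set S) (B E : clause S) : Prop :=
  exists2 Ds : seq (clause S),
    (forall D, D \in Ds -> N D /\ cgt B D) & entails (fun D => D \in Ds) E.

Definition GRedCl (N : clause_set S) (C : clause S) : Prop :=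
  ground_clause C /\ entailed_below N C C.

Definition RedCl (N : clause_set S) (C : clause S) : Prop :=
  wf_clause C /\
  forall D, G C D ->
    GRedCl (GN N) D \/
    exists C', [/\ N C', G C' D & strictly_subsumes C' C].

Definition GRedI (gsel : selection) (N : clause_set S) (ig : ginference) : Prop :=
  GInf gsel ig /\
  ((exists2 C, C \in gprems ig & GRedCl N C) \/
   entailed_below N (max_prem ig) (gconcl ig)).

Definition RedI (sel : selection) (N : clause_set S) (i : inference) : Prop :=
  Inf sel i /\
  forall gsel, Gsel sel gsel -> forall ig, GI gsel i ig -> GRedI gsel (GN N) ig.

Definition is_derivation (N : nat -> clause_set S) : Prop :=
  forall i C, N i C -> ~ N i.+1 C -> RedCl (N i.+1) C.

Definition limit (N : nat -> clause_set S) : clause_set S :=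
  fun C => exists i, forall j, i <= j -> N j C.

Definition fair (sel : selection) (N : nat -> clause_set S) : Prop :=
  forall iota, Inf sel iota -> (forall C, C \in prems iota -> limit N C) ->
    exists i, RedI sel (N i) iota.

End Calculus.

(* Main.v *)
From Stdlib Require Import Classical ClassicalEpsilon FunctionalExtensionality Wellfounded.
From Stdlib Require List.
From mathcomp Require Import all_boot finmap multiset zify.
Require Import Defs.

(* Ground completeness is a model construction without rewriting theory: a
   partial function from ground terms to smaller ones (the rules) induces, by
   recursion on the ordering, a normal-form map, and the normal forms are the
   carrier of an interpretation in which rules hold whenever their left-hand
   sides have normal arguments.  The rule for [t] is taken from the least
   non-redundant clause whose strictly maximal literal is [t ≈ t'] and whose
   other literals are false once [t -> t'] is added to the rules for smaller
   terms.  A minimal false clause would then be reduced by some ground inference,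
   whose conclusion is true because the inference is redundant.

   For a fair derivation, the selection of a ground clause is inherited from a
   clause of the limit of which it is an instance; every ground inference is then
   an instance of an inference from the limit, except for superpositions at or
   below a variable, which are redundant.  Finally a ground instance of a clause
   of the derivation is an instance of the limit or redundant with respect to
   it, by induction on the clause ordering and on strict subsumption. *)

Set Implicit Arguments.
Unset Strict Implicit.
Unset Printing Implicit Defensive.

Local Open Scope fset_scope.
Local Open Scope mset_scope.
Local Open Scope nat_scope.

(* Keeps failing unifications from unfolding multisets into finite maps. *)
Opaque msetn msetD msetB seq_mset.

(** * Multisets *)

Section Multisets.
Context (T : choiceType).
Implicit Types (A B : {mset T}).

(** Testing the rest of a producing clause with the new rule already added is what ties the
    construction to equality factoring: a second literal [t ≈ v] may become true through the very
    rule that the clause produces, and then the clause could no longer serve as a premise whose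
    remaining literals are false. A minimal counterexample of that kind has two right-hand sides
    with the same normal form, and factoring applies to it. The ground selection is fixed before
    ground completeness is invoked, whereas fairness yields a separate stage for each inference;
    since [RedI] quantifies over all of [Gsel], the selection built from the limit is covered at
    every stage. The delicate part of moving redundancy to the limit is deletion by subsumption. The
    ground instance stays the same, so a measure on non-ground clauses must decrease, and it has to
    notice that p(x,y) strictly subsumes p(x,x) although both have the same size. Ground terms in
    every sort make the domains of normal forms non-empty and turn a grounding substitution into one
    that is ground everywhere. *)

Definition msetE (K : choiceType) :=
  (@mset0E K, @mset1DE K, @msetB1E K, @msetE2 K, @msetnE K, @mset_seqE K).

Lemma mem_seq_mset (s : seq T) x : (x \in seq_mset s) = (x \in s).
Proof. by rewrite (perm_mem (perm_eq_seq_mset s)). Qed.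

Lemma seq_mset_cat (s s' : seq T) :
  seq_mset (s ++ s') = seq_mset s `+` seq_mset s'.
Proof. by apply/msetP => x; rewrite !msetE count_cat. Qed.

Lemma perm_msetD A B : perm_eq (A `+` B) (A ++ B).
Proof.
by apply/eq_seq_msetP; rewrite seq_mset_cat !seq_mset_id.
Qed.

Lemma msetB1D A x : x \in A -> A = A `\ x `+` [mset x].
Proof. by move=> xA; rewrite msetDC msetB1K. Qed.

Lemma msetD1I A B x : A `+` [mset x] = B `+` [mset x] -> A = B.
Proof. by move/(congr1 (fun C => C `\ x)); rewrite !msetDKBC. Qed.

Lemma msetD1B A x : (A `+` [mset x]) `\ x = A.
Proof. exact: msetDKBC. Qed.

Lemma in_msetD1r A x y : (y \in A `+` [mset x]) = (y \in A) || (y == x).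
Proof. by rewrite in_msetD in_mset1. Qed.

Lemma mset_sumE (F : T -> nat) A B :
  \sum_(x <- A `+` B) F x = \sum_(x <- A) F x + \sum_(x <- B) F x.
Proof. by rewrite (perm_big _ (perm_msetD A B)) big_cat. Qed.

Lemma mset_split (P : T -> Prop) A : exists A1 A2,
  [/\ A = A1 `+` A2, forall x, x \in A1 -> P x & forall x, x \in A2 -> ~ P x].
Proof.
pose p x : bool := excluded_middle_informative (P x).
have pP x : reflect (P x) (p x) by rewrite /p; case: excluded_middle_informative => h; constructor.
exists (seq_mset (filter p A)), (seq_mset (filter (predC p) A)); split.
- rewrite -seq_mset_cat -[A in LHS]seq_mset_id; apply/eq_seq_msetP.
  by rewrite perm_sym; apply/permPl/perm_filterC.
- by move=> x; rewrite mem_seq_mset mem_filter => /andP[/pP].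
- by move=> x; rewrite mem_seq_mset mem_filter => /andP[/pP].
Qed.

End Multisets.

Section MultisetMap.
Context (T U : choiceType).
Implicit Types (A B : {mset T}) (f : T -> U).

Lemma mmap_seq_mset f (s : seq T) : mmap f (seq_mset s) = seq_mset (map f s).
Proof. exact/eq_seq_msetP/perm_map/perm_eq_seq_mset. Qed.

Lemma mmapD f A B : mmap f (A `+` B) = mmap f A `+` mmap f B.
Proof.
rewrite /mmap -seq_mset_cat -map_cat; exact/eq_seq_msetP/perm_map/perm_msetD.
Qed.

Lemma mmap1 f x : mmap f [mset x] = [mset f x].
Proof. by apply/msetP => y; rewrite /mmap enum_msetn !msetE /= eq_sym addn0; case: eqP. Qed.

Lemma mmapP f A y : y \in mmap f A -> exists2 x, x \in A & y = f x.
Proof. by rewrite mem_seq_mset => /mapP. Qed.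

Lemma mem_mmap f A x : x \in A -> f x \in mmap f A.
Proof. by rewrite mem_seq_mset; apply: map_f. Qed.

Lemma eq_in_mmap f g A : (forall x, x \in A -> f x = g x) -> mmap f A = mmap g A.
Proof. by move=> fg; congr seq_mset; apply/eq_in_map. Qed.

Lemma mmap_eqD1 f A (B : {mset U}) y x : mmap f A = B `+` [mset y] ->
  x \in A -> f x = y -> [/\ A = A `\ x `+` [mset x] & mmap f (A `\ x) = B].
Proof.
move=> fA xA fx; split; first exact: msetB1D.
move: fA; rewrite {1}(msetB1D xA) mmapD mmap1 fx; exact: msetD1I.
Qed.

End MultisetMap.

Lemma mmap_id (T : choiceType) (A : {mset T}) (f : T -> T) :
  (forall x, x \in A -> f x = x) -> mmap f A = A.
Proof. by move=> fE; rewrite (eq_in_mmap fE) /mmap map_id seq_mset_id. Qed.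

Lemma mmap_comp (T U V : choiceType) (f : T -> U) (g : U -> V) (A : {mset T}) :
  mmap g (mmap f A) = mmap (g \o f) A.
Proof. by rewrite {2}/mmap mmap_seq_mset -map_comp. Qed.

(** * The multiset extension of an ordering *)

Section MultisetOrder.
Context (T : choiceType) (r : T -> T -> Prop).
Implicit Types (M N : {mset T}).

Lemma mulgt_dominated M N : M != mset0 ->
  (forall y, y \in N -> exists2 x, x \in M & r x y) -> mulgt r M N.
Proof. by move=> M0 h; exists M, N; rewrite msetBxx mset0D msubset_refl; split. Qed.

Lemma mulgt_trans :
  (forall x y z, r x y -> r y z -> r x z) ->
  forall M N P, mulgt r M N -> mulgt r N P -> mulgt r M P.
Proof.
move=> rT M N P [X [Y [X0 XM -> XY]]] [X2 [Y2 [_ X2N -> XY2]]].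
(* The second step removes [X2]: the part introduced by the first step cancels against [Y], the rest
   comes from [M]. *)
exists (X `+` (X2 `\` Y)), ((Y `\` X2) `+` Y2).
move/msubsetP: XM => XM; move/msubsetP: X2N => X2N; split.
- apply: contraNneq X0 => /msetP X0; apply/eqP/msetP => x.
  by move: (X0 x); rewrite !msetE; lia.
- by apply/msubsetP => x; move: (XM x) (X2N x); rewrite !msetE; lia.
- by apply/msetP => x; move: (XM x) (X2N x); rewrite !msetE; lia.
- move=> y; rewrite in_msetD => /orP[yY|/XY2[x xX2 rxy]].
    have /XY[x xX rxy] : y \in Y by move: yY; rewrite in_msetB in_mset; lia.
    by exists x => //; rewrite in_msetD xX.
  case: (boolP (x \in Y)) => [/XY[z zX rzx]|xY].
    by exists z; [rewrite in_msetD zX | apply: rT rzx rxy].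
  exists x => //; rewrite in_msetD in_msetB; move: xY xX2.
  by rewrite !in_mset; lia.
Qed.

(** Accessibility is preserved by adding one element [a], by induction on [a] and, inside, on the
    accessibility of [M]; every multiset is then reached from the empty one. *)
Lemma mulgt_wf : well_founded (fun y x => r x y) ->
  well_founded (fun N M => mulgt r M N).
Proof.
move=> rwf; set R := fun N M => mulgt r M N.
have addm a : forall M, Acc R M -> Acc R (M `+` [mset a]).
  elim/(well_founded_induction rwf): a => a IHa M accM.
  elim: accM => {}M accM IHM; constructor=> _ [X [Y [X0 XM -> XY]]].
  (* Either the removed part fits into [M] and the step is one from [M] with [a] carried along, or
     it consumes the added copy of [a]. *)
  have [XM'|XM'] := boolP (X `<=` M).
    have -> : (M `+` [mset a]) `\` X `+` Y = (M `\` X `+` Y) `+` [mset a].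
      apply/msetP => x; move/msubsetP/(_ x): XM' => XM'; rewrite !msetE; lia.
    by apply: IHM; exists X, Y.
  have aX : a \in X.
    apply/negPn; apply: contraNN XM' => aX; apply/msubsetP => x.
    move/msubsetP/(_ x): XM; rewrite !msetE; case: eqP => [->|]; last lia.
    by move: aX; rewrite in_mset; lia.
  (* Elements not below [a] must be dominated by the rest of [X], so they come from a step out of
     [M]; those below [a] are put back one at a time by the outer induction. *)
  have [Y1 [Y2 [YE Y1P Y2P]]] := mset_split (fun y => r a y) Y.
  have -> : (M `+` [mset a]) `\` X `+` Y = (M `\` (X `\ a) `+` Y2) `+` Y1.
    apply/msetP => x; rewrite YE; move/msubsetP/(_ x): XM; move: aX.
    by rewrite in_mset !msetE; case: eqP => [->|]; lia.
  have: Acc R (M `\` (X `\ a) `+` Y2).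
    have XaM : X `\ a `<=` M.
      apply/msubsetP => x; move/msubsetP/(_ x): XM; rewrite !msetE.
      by case: eqP; lia.
    have Y2X y : y \in Y2 -> exists2 x, x \in X `\ a & r x y.
      move=> yY2; have [|x xX rxy] := XY y; first by rewrite YE in_msetD yY2 orbT.
      exists x => //; move: xX; rewrite {1}(msetB1D aX) in_msetD1r.
      by case/orP=> // /eqP xa; case: (Y2P _ yY2); rewrite -xa.
    (* A step has to remove something; if only [a] was removed, [Y2] is empty and the multiset is
       [M] itself. *)
    have [Xa0|Xa0] := eqVneq (X `\ a) mset0.
      suff -> : Y2 = mset0 by rewrite Xa0 msetB0 msetD0; constructor.
      have [//|[y]] := mset_0Vmem Y2.
      by move=> /Y2X[x]; rewrite Xa0 in_mset0.
    by apply: accM; exists (X `\ a), Y2.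
  move: (_ `+` Y2) => Z; rewrite -(seq_mset_id Y1).
  have: forall y, y \in (Y1 : seq T) -> r a y by [].
  elim: (Y1 : seq T) Z => [|y s IHs] Z sP accZ.
    by rewrite (_ : seq_mset [::] = mset0) ?msetD0 //; apply/msetP => x; rewrite !msetE.
  rewrite mset_cons msetDA; apply: IHs => [z zs|].
    by apply: sP; rewrite in_cons zs orbT.
  by apply: IHa => //; apply: sP; rewrite mem_head.
move=> M; rewrite -(seq_mset_id M); elim: (M : seq T) => [|x s IHs].
  constructor=> N [X [Y [X0 XM _ _]]]; case/negP: X0.
  rewrite -msubset0; apply: msubset_trans XM _; apply/msubsetP => x.
  by rewrite !msetE.
by rewrite mset_cons msetDC; apply: addm.
Qed.

Lemma mulgt_sub (r' : T -> T -> Prop) M N :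
  (forall x y, x \in M -> y \in N -> r x y -> r' x y) ->
  mulgt r M N -> mulgt r' M N.
Proof.
move=> h [X [Y [X0 XM NE XY]]]; exists X, Y; split=> // y yY.
have [x xX rxy] := XY y yY; exists x => //; apply: h => //.
- exact: msubset_subset xX.
- by rewrite NE in_msetD yY orbT.
Qed.

Lemma exists_maximal :
  (forall x y z, r x y -> r y z -> r x z) -> (forall x, ~ r x x) ->
  forall M, M != mset0 ->
  exists2 x, x \in M & forall y, y \in M -> ~ r y x.
Proof.
move=> rT rI M; have [->|[x0 x0M _]] := mset_0Vmem M; first by rewrite eqxx.
have h x : (x \in M) = (x \in (M : seq T)) by [].
suff : exists2 x, x \in (M : seq T) & forall y, y \in (M : seq T) -> ~ r y x by [].
move: x0M; rewrite h; elim: (M : seq T) x0 {h} => // x s IHs x0 _.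
case: s IHs => [_|y s /(_ y (mem_head _ _))[m ms mmax]].
  by exists x; rewrite ?mem_head // => y; rewrite inE => /eqP ->; apply: rI.
have [rxm|nrxm] := classic (r x m).
  exists x; rewrite ?mem_head // => z; rewrite inE => /orP[/eqP ->|zs rzx]; first exact: rI.
  exact: (mmax _ zs (rT _ _ _ rzx rxm)).
exists m; first by rewrite inE ms orbT.
by move=> z; rewrite inE => /orP[/eqP ->|/mmax].
Qed.

(** A maximal element of the symmetric difference decides: the multiset that has it in excess
    dominates everything the other one has in excess. *)
Lemma mulgt_total :
  (forall x y z, r x y -> r y z -> r x z) -> (forall x, ~ r x x) ->
  forall M N, (forall x y, x \in M `+` N -> y \in M `+` N ->
                 [\/ x = y, r x y | r y x]) ->
  [\/ M = N, mulgt r M N | mulgt r N M].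
Proof.
move=> rT rI M N tot.
have [-> |neq] := eqVneq M N; first by constructor 1.
have P0 : (M `\` N) `+` (N `\` M) != mset0.
  apply: contra_neqN neq => /eqP/msetP h; apply/msetP => x.
  by move: (h x); rewrite !msetE; lia.
have [m mP mmax] := exists_maximal rT rI P0.
have inMN (x : T) : x \in (M `\` N) `+` (N `\` M) -> x \in M `+` N.
  by rewrite !in_msetD !in_msetB !in_mset; lia.
have main (A B : {mset T}) : m \in A `\` B ->
    (forall x, x \in B `\` A -> x \in (M `\` N) `+` (N `\` M)) -> mulgt r A B.
  move=> mAB BA; exists (A `\` B), (B `\` A); split.
  - by apply: contraTneq mAB => ->; rewrite in_mset0.
  - by apply/msubsetP => x; rewrite !msetE; lia.
  - by apply/msetP => x; rewrite !msetE; lia.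
  - move=> y yBA; exists m => //.
    have [] := tot m y (inMN _ mP) (inMN _ (BA _ yBA)) => // [my|rym].
      by move: mAB yBA; rewrite my !in_msetB; lia.
    by case: (mmax _ (BA _ yBA) rym).
move: (mP); rewrite in_msetD => /orP[mMN|mNM].
- by constructor 2; apply: main => // x xNM; rewrite in_msetD xNM orbT.
- by constructor 3; apply: main => // x xMN; rewrite in_msetD xMN.
Qed.

End MultisetOrder.

(** [f] may identify elements, because images of multisets keep multiplicities. *)
Lemma mulgt_mmap (T U : choiceType) (r : T -> T -> Prop) (r' : U -> U -> Prop)
    (f : T -> U) (M N : {mset T}) :
  (forall x y, x \in M -> y \in N -> r x y -> r' (f x) (f y)) ->
  mulgt r M N -> mulgt r' (mmap f M) (mmap f N).
Proof.
move=> h [X [Y [X0 XM NE XY]]]; exists (mmap f X), (mmap f Y).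
have ME : mmap f M = mmap f (M `\` X) `+` mmap f X by rewrite -mmapD msetBDK.
split.
- have [X0'|[x xX]] := mset_0Vmem X; first by rewrite X0' eqxx in X0.
  by apply: contraTneq (mem_mmap f xX) => ->; rewrite in_mset0.
- by rewrite ME; apply/msubsetP => x; rewrite !msetE; lia.
- by rewrite NE mmapD ME msetDKBC.
- move=> y /mmapP[y0 y0Y ->]; have [x xX rxy] := XY _ y0Y.
  exists (f x); first exact: mem_mmap.
  by apply: h => //; [exact: msubset_subset xX | rewrite NE in_msetD y0Y orbT].
Qed.

Lemma mulgt_mmap_lt (T U : choiceType) (r : U -> U -> Prop) (f g : T -> U)
    (M : {mset T}) :
  (forall x, x \in M -> f x = g x \/ r (f x) (g x)) ->
  (exists2 x, x \in M & r (f x) (g x)) -> mulgt r (mmap f M) (mmap g M).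
Proof.
move=> h [x0 x0M rx0].
have [M1 [M2 [ME M1P M2P]]] := mset_split (fun x => r (f x) (g x)) M.
have E : mmap f M2 = mmap g M2.
  apply: eq_in_mmap => x xM2; have [] := h x => //.
    by rewrite ME in_msetD xM2 orbT.
  by move=> rx; case: (M2P _ xM2).
have x0M1 : x0 \in M1.
  by move: x0M; rewrite ME in_msetD => /orP[//|/M2P].
exists (mmap f M1), (mmap g M1); split.
- by apply: contraTneq (mem_mmap f x0M1) => ->; rewrite in_mset0.
- by rewrite ME mmapD; apply/msubsetP => x; rewrite !msetE; lia.
- by rewrite ME !mmapD E msetDKB msetDC.
- by move=> y /mmapP[x xM1 ->]; exists (f x); [exact: mem_mmap | exact: M1P].
Qed.

(** * Terms, literals and clauses *)

Section TermTheory.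
Context (S : signature).
Implicit Types (s t u : term S) (sigma tau theta : subst S) (K : ctx S).
Implicit Types (l : literal S) (C D : clause S).

Lemma term_mem_ind (P : term S -> Prop) :
  (forall x, P (Var x)) ->
  (forall f ts, (forall t, t \in ts -> P t) -> P (App f ts)) -> forall t, P t.
Proof.
move=> HV HA; elim/term_nested_ind => [//|f ts IH]; apply: HA.
by elim: IH => // u us Pu _ IHus t; rewrite inE => /orP[/eqP ->|/IHus].
Qed.

Lemma mem_tvars_App (f : fsym S) ts (x : var S) :
  reflect (exists2 t, t \in ts & x \in tvars t) (x \in tvars (App f ts)).
Proof.
apply: (iffP flattenP) => [[_ /mapP[t tts ->] xt]|[t tts xt]]; first by exists t.
by exists (tvars t) => //; apply: map_f.
Qed.

Lemma tsubst_comp tau sigma t :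
  tsubst tau (tsubst sigma t) = tsubst (fun x => tsubst tau (sigma x)) t.
Proof.
elim/term_mem_ind: t => //= f ts IH; congr App; rewrite -map_comp.
exact/eq_in_map.
Qed.

Lemma eq_in_tsubst sigma tau t :
  (forall x, x \in tvars t -> sigma x = tau x) -> tsubst sigma t = tsubst tau t.
Proof.
elim/term_mem_ind: t => [x h|f ts IH h] /=; first by apply: h; rewrite mem_head.
congr App; apply/eq_in_map => t tts; apply: IH => // x xt; apply: h.
by apply/mem_tvars_App; exists t.
Qed.

Lemma tsubst_inj_in sigma tau t : tsubst sigma t = tsubst tau t ->
  forall x, x \in tvars t -> sigma x = tau x.
Proof.
elim/term_mem_ind: t => [x /= h y|f ts IH [] /eq_in_map h x]; first by rewrite inE => /eqP ->.
by case/mem_tvars_App => t tts xt; apply: (IH t tts) => //; apply: h.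
Qed.

Lemma tsubst_id t : tsubst (@Var S) t = t.
Proof.
elim/term_mem_ind: t => //= f ts IH; congr App.
by rewrite -[RHS]map_id; apply/eq_in_map.
Qed.

Lemma ty_tsubst sigma t : wt_subst sigma -> ty_of (tsubst sigma t) = ty_of t.
Proof. by move=> h; case: t => //= x; case: (h x). Qed.

Lemma map_ty_tsubst sigma ts : wt_subst sigma ->
  map (@ty_of S) (map (tsubst sigma) ts) = map (@ty_of S) ts.
Proof. by move=> h; rewrite -map_comp; apply: eq_map => t /=; rewrite ty_tsubst. Qed.

Lemma wt_tsubst sigma t : wt_subst sigma -> wt t -> wt (tsubst sigma t).
Proof.
move=> h; elim/term_mem_ind: t => [x _|f ts IH /= /andP[/allP wts ty_ts]].
  by case: (h x).
rewrite map_ty_tsubst // ty_ts andbT; apply/allP => _ /mapP[t tts ->].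
exact: IH (wts _ tts).
Qed.

Lemma mem_tvars_tsubst sigma t (y : var S) :
  reflect (exists2 x, x \in tvars t & y \in tvars (sigma x))
          (y \in tvars (tsubst sigma t)).
Proof.
apply: (iffP idP).
  elim/term_mem_ind: t => [x yx|f ts IH /=]; first by exists x; rewrite ?mem_head.
  move/(mem_tvars_App f) => [_ /mapP[t tts ->] /(IH _ tts)[x xt yx]].
  by exists x => //; apply/(mem_tvars_App f); exists t.
elim/term_mem_ind: t => [x [z]|f ts IH [x /mem_tvars_App[t tts xt] yx]] /=.
  by rewrite inE => /eqP ->.
apply/(mem_tvars_App f); exists (tsubst sigma t); first exact: map_f.
by apply: IH => //; exists x.
Qed.

Lemma ground_wt t : ground_term t -> wt t.
Proof. by case/andP. Qed.

Lemma ground_tvars t x : ground_term t -> x \in tvars t = false.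
Proof. by case/andP => _ /nilP ->. Qed.

Lemma groundP t : reflect (wt t /\ forall x, x \notin tvars t) (ground_term t).
Proof.
apply: (iffP andP) => [[-> /nilP ->]//|[-> h]]; split=> //.
by case: (tvars t) h => // x s /(_ x); rewrite mem_head.
Qed.

Lemma ground_AppP f (ts : seq (term S)) :
  reflect ((forall t, t \in ts -> ground_term t) /\ map (@ty_of S) ts = arg_tys f)
          (ground_term (App f ts)).
Proof.
apply: (iffP (groundP _)) => [[/= /andP[/allP wts /eqP tyts] h]|[gts tyts]].
  split=> // t tts; apply/groundP; split; first exact: wts.
  by move=> x; apply: contra (h x) => xt; apply/(mem_tvars_App f); exists t.
split=> [/=|x].
  by rewrite tyts eqxx andbT; apply/allP => t /gts/ground_wt.
by apply/negP => /(mem_tvars_App f)[t /gts/ground_tvars ->].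
Qed.

Definition ground_subst theta : Prop :=
  forall x, ground_term (theta x) /\ ty_of (theta x) = x.1.

Lemma ground_subst_wt theta : ground_subst theta -> wt_subst theta.
Proof. by move=> h x; case: (h x) => /ground_wt. Qed.

Lemma ground_tsubst theta t : ground_subst theta -> wt t -> ground_term (tsubst theta t).
Proof.
move=> h wt_t; apply/groundP; split; first exact/wt_tsubst/wt_t/ground_subst_wt.
by move=> x; apply/negP => /mem_tvars_tsubst[y _]; rewrite ground_tvars //; case: (h y).
Qed.

Lemma ground_tsubst_id theta t : ground_term t -> tsubst theta t = t.
Proof.
by move=> gt_t; rewrite -[RHS]tsubst_id; apply: eq_in_tsubst => x; rewrite ground_tvars.
Qed.

Lemma ground_plug_inv K t : ground_term (plug K t) -> ground_term t.
Proof.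
elim: K t => //= f us K IH vs t /ground_AppP[h _].
by apply: IH; apply: h; rewrite mem_cat mem_head orbT.
Qed.

Lemma ground_plug K t t' : ground_term (plug K t) -> ground_term t' ->
  ty_of t = ty_of t' -> ground_term (plug K t') /\ ty_of (plug K t) = ty_of (plug K t').
Proof.
elim: K => //= f us K IH vs /ground_AppP[h tyE] gt' ty_t.
have [|//|//|gK tyK] := IH; first by apply: h; rewrite mem_cat mem_head orbT.
split=> //; apply/ground_AppP; split.
  move=> u; rewrite mem_cat inE => /or3P[uus|/eqP -> //|uvs]; apply: h.
    by rewrite mem_cat uus.
  by rewrite mem_cat inE uvs !orbT.
by rewrite -tyE !map_cat /= tyK.
Qed.

Lemma mset2_eq (T : choiceType) (a b c d : T) :
  [mset a] `+` [mset b] = [mset c] `+` [mset d] ->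
  (a = c /\ b = d) \/ (a = d /\ b = c).
Proof.
move=> E; have : a \in [mset c] `+` [mset d] by rewrite -E mset1D1.
rewrite in_msetD !in_mset1 => /orP[]/eqP ac; subst a.
  left; split=> //; move: E; rewrite ![[mset c] `+` _]msetDC => /msetD1I.
  by move/(congr1 (fun A : {mset T} => b \in A)); rewrite mset11 in_mset1 => /esym/eqP.
right; split=> //; move: E; rewrite msetDC => /msetD1I.
by move/(congr1 (fun A : {mset T} => b \in A)); rewrite mset11 in_mset1 => /esym/eqP.
Qed.

Lemma lit_inj b b' s t s' t' : lit b s t = lit b' s' t' ->
  b = b' /\ ((s = s' /\ t = t') \/ (s = t' /\ t = s')).
Proof. by case=> -> /mset2_eq. Qed.

Lemma mem_lit b s t u : (u \in (lit b s t).2) = (u == s) || (u == t).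
Proof. by rewrite /= in_msetD !in_mset1. Qed.

Lemma mem_lit_mset l u : (u \in lit_mset l) = (u \in l.2).
Proof. by rewrite /lit_mset; case: l.1 => //; rewrite in_msetD orbb. Qed.

Lemma wf_lit b s t : wf_literal (lit b s t) <-> [/\ wt s, wt t & ty_of s = ty_of t].
Proof.
split=> [[s' [t' [/lit_inj[_ [][-> ->]] ? ? ?]]]|[*]] //; by exists s, t.
Qed.

Lemma lsubst_lit sigma b s t :
  lsubst sigma (lit b s t) = lit b (tsubst sigma s) (tsubst sigma t).
Proof. by rewrite /lsubst /= mmapD !mmap1. Qed.

Lemma csubstD sigma C D : csubst sigma (C `+` D) = csubst sigma C `+` csubst sigma D.
Proof. exact: mmapD. Qed.

Lemma csubst1 sigma l : csubst sigma [mset l] = [mset lsubst sigma l].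
Proof. exact: mmap1. Qed.

Lemma lsubst_comp tau sigma l :
  lsubst tau (lsubst sigma l) = lsubst (fun x => tsubst tau (sigma x)) l.
Proof.
by rewrite /lsubst /= mmap_comp; congr pair; apply: eq_in_mmap => t _; apply: tsubst_comp.
Qed.

Lemma csubst_comp tau sigma C :
  csubst tau (csubst sigma C) = csubst (fun x => tsubst tau (sigma x)) C.
Proof. by rewrite /csubst mmap_comp; apply: eq_in_mmap => l _; apply: lsubst_comp. Qed.

Lemma lsubst_id l : lsubst (@Var S) l = l.
Proof. by case: l => b m; rewrite /lsubst mmap_id // => t _; apply: tsubst_id. Qed.

Lemma csubst_id C : csubst (@Var S) C = C.
Proof. by apply: mmap_id => l _; apply: lsubst_id. Qed.

Lemma eq_in_lsubst sigma tau l :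
  (forall t, t \in l.2 -> tsubst sigma t = tsubst tau t) -> lsubst sigma l = lsubst tau l.
Proof. by move=> h; congr pair; apply: eq_in_mmap. Qed.

Lemma eq_lsubst sigma tau l : sigma =1 tau -> lsubst sigma l = lsubst tau l.
Proof. by move=> h; apply: eq_in_lsubst => t _; apply: eq_in_tsubst => x _. Qed.

Lemma eq_csubst sigma tau C : sigma =1 tau -> csubst sigma C = csubst tau C.
Proof. by move=> h; apply: eq_in_mmap => l _; apply: eq_lsubst. Qed.

Lemma mem_cvars C (x : var S) :
  reflect (exists l t, [/\ l \in C, t \in l.2 & x \in tvars t]) (x \in cvars C).
Proof.
apply: (iffP flattenP) => [[_ /mapP[l lC ->] /flattenP[_ /mapP[t tl ->] xt]]|].
  by exists l, t.
move=> [l [t [lC tl xt]]]; exists (flatten [seq tvars t | t <- l.2]).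
  by apply/mapP; exists l.
by apply/flattenP; exists (tvars t) => //; apply: map_f.
Qed.

Lemma eq_in_csubst sigma tau C :
  (forall x, x \in cvars C -> sigma x = tau x) -> csubst sigma C = csubst tau C.
Proof.
move=> h; apply: eq_in_mmap => l lC; apply: eq_in_lsubst => t tl.
by apply: eq_in_tsubst => x xt; apply: h; apply/mem_cvars; exists l, t.
Qed.

Definition ground_lit l : Prop :=
  exists s t, [/\ l = lit l.1 s t, ground_term s, ground_term t & ty_of s = ty_of t].

Lemma ground_lit_lit b s t :
  ground_lit (lit b s t) <-> [/\ ground_term s, ground_term t & ty_of s = ty_of t].
Proof.
split=> [[s' [t' [/lit_inj[_ [][-> ->]] ? ? ?]]]|[*]] //; by exists s, t.
Qed.

Lemma ground_lit_mem l u : ground_lit l -> u \in l.2 -> ground_term u.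
Proof. by move=> [s [t [-> gs gt_t _]]]; rewrite mem_lit => /orP[]/eqP ->. Qed.

Lemma ground_clauseP C : ground_clause C <-> forall l, l \in C -> ground_lit l.
Proof.
split=> [[wfC /nilP vC] l lC|h].
  have [s [t [lE ws wt_t tyE]]] := wfC _ lC; exists s, t; split=> //.
    apply/groundP; split=> // x; apply/negP => xs.
    suff : x \in cvars C by rewrite vC.
    by apply/mem_cvars; exists l, s; rewrite {2}lE mem_lit eqxx.
  apply/groundP; split=> // x; apply/negP => xt.
  suff : x \in cvars C by rewrite vC.
  by apply/mem_cvars; exists l, t; rewrite {2}lE mem_lit eqxx orbT.
split=> [l /h[s [t [lE gs gt_t tyE]]]|].
  by exists s, t; split=> //; apply: ground_wt.
case vC: (cvars C) => [//|x vs].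
have /mem_cvars[l [t [lC tl xt]]] : x \in cvars C by rewrite vC mem_head.
by move: xt; rewrite ground_tvars //; apply: ground_lit_mem tl; apply: h.
Qed.

Lemma ground_clauseD C D : ground_clause (C `+` D) <-> ground_clause C /\ ground_clause D.
Proof.
rewrite !ground_clauseP; split=> [h|[hC hD] l].
  by split=> l lC; apply: h; rewrite in_msetD lC ?orbT.
by rewrite in_msetD => /orP[/hC|/hD].
Qed.

Lemma ground_clauseDI C D : ground_clause C -> ground_clause D -> ground_clause (C `+` D).
Proof. by move=> gC gD; apply: (proj2 (ground_clauseD C D)). Qed.

Lemma ground_clause1 l : ground_clause [mset l] <-> ground_lit l.
Proof.
rewrite ground_clauseP; split=> [|h l']; first by apply; rewrite mset11.
by rewrite in_mset1 => /eqP ->.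
Qed.

Lemma lsubst_wf sigma l : wt_subst sigma -> wf_literal l -> wf_literal (lsubst sigma l).
Proof.
move=> h [s [t [-> ws wt_t tyE]]]; rewrite lsubst_lit; apply/wf_lit.
by split; rewrite ?ty_tsubst //; apply: wt_tsubst.
Qed.

Lemma csubst_wf sigma C : wt_subst sigma -> wf_clause C -> wf_clause (csubst sigma C).
Proof. by move=> h wfC _ /mmapP[l lC ->]; apply: lsubst_wf => //; apply: wfC. Qed.

Lemma csubst_ground theta C : ground_subst theta -> wf_clause C ->
  ground_clause (csubst theta C).
Proof.
move=> h wfC; apply/ground_clauseP => _ /mmapP[l lC ->].
have [s [t [-> ws wt_t tyE]]] := wfC _ lC; rewrite lsubst_lit; apply/ground_lit_lit.
have wth := ground_subst_wt h.
by split; rewrite ?ty_tsubst //; apply: ground_tsubst.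
Qed.

Lemma wf_literal_mem l u : wf_literal l -> u \in l.2 -> wt u.
Proof. by move=> [s [t [-> ? ? _]]]; rewrite mem_lit => /orP[]/eqP ->. Qed.

Lemma lit_mset_lsubst sigma l : lit_mset (lsubst sigma l) = mmap (tsubst sigma) (lit_mset l).
Proof. by rewrite /lit_mset /=; case: l.1; rewrite ?mmapD. Qed.

Section Inhabited.
Hypothesis ty_inhabited : forall tau : ty S, exists2 t : term S, ground_term t & ty_of t = tau.

(** [G] only forces the substitution to be ground on the variables of [C]; elsewhere it can be
    redefined by ground terms of the right sort. *)
Lemma ground_instance C D : G C D ->
  exists2 theta, ground_subst theta & D = csubst theta C.
Proof.
move=> [gD [theta wth DE]].
have [h hP] : exists h : ty S -> term S, forall ta : ty S, ground_term (h ta) /\ ty_of (h ta) = ta.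
  apply: (choice (fun (ta : ty S) t => ground_term t /\ ty_of t = ta)) => ta.
  by have [t] := ty_inhabited ta; exists t.
exists (fun x => if ground_term (theta x) then theta x else h x.1).
  by move=> x; case: ifP => // gx; split=> //; case: (wth x).
rewrite DE; apply: eq_in_csubst => x xC; case: ifP => // /groundP[]; split.
  by case: (wth x).
move=> y; apply/negP => yx; move/mem_cvars: xC => [l [t [lC tl xt]]].
have : tsubst theta t \in (lsubst theta l).2 by apply: mem_mmap.
move/ground_lit_mem => gt_t.
have : ground_term (tsubst theta t).
  by apply: gt_t; move/ground_clauseP: gD; apply; rewrite DE; apply: mem_mmap.
by move/ground_tvars => /(_ y) /negP; apply; apply/mem_tvars_tsubst; exists x.
Qed.

End Inhabited.

Lemma ground_subst_G theta C : ground_subst theta -> wf_clause C -> G C (csubst theta C).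
Proof.
move=> h wfC; split; first exact: csubst_ground.
by exists theta => //; apply: ground_subst_wt.
Qed.

End TermTheory.

(** * The ordering on ground terms, literals and clauses *)

Lemma wf_irrefl (T : Type) (r : T -> T -> Prop) :
  well_founded (fun y x => r x y) -> forall x, ~ r x x.
Proof. by move=> rwf x; elim/(well_founded_induction rwf): x => x IH /[dup] /IH. Qed.

Section GroundOrder.
Context (S : signature) (gt : term S -> term S -> Prop).
Hypothesis gt_simpl : simplification_order gt.
Implicit Types (s t u : term S) (l : literal S) (C D : clause S).

(** [gt] is constrained on well-typed terms only. Its ground restriction is transitive and
    well-founded without side conditions, so the general multiset lemmas apply to it. *)
Definition ggt s t : Prop := [/\ ground_term s, ground_term t & gt s t].

Lemma ggt_trans s t u : ggt s t -> ggt t u -> ggt s u.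
Proof.
move=> [gs gt_t st] [_ gu tu]; split=> //.
exact: (so_trans gt_simpl) (ground_wt gs) (ground_wt gt_t) (ground_wt gu) st tu.
Qed.

Lemma ggt_wf : well_founded (fun t s => ggt s t).
Proof.
apply: wf_incl (so_wf gt_simpl).
by move=> t s [gs gt_t st]; split=> //; apply: ground_wt.
Qed.

Lemma ggt_irr t : ~ ggt t t.
Proof. exact: wf_irrefl ggt_wf t. Qed.

Lemma ggt_asym s t : ggt s t -> ~ ggt t s.
Proof. by move=> st ts; apply: (@ggt_irr s); apply: ggt_trans ts. Qed.

Lemma ggt_total s t : ground_term s -> ground_term t -> [\/ s = t, ggt s t | ggt t s].
Proof.
move=> gs gt_t; case: (so_total gt_simpl gs gt_t) => h.
- by constructor 1. - by constructor 2. - by constructor 3.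
Qed.

Lemma ggt_plug K t t' : ggt t t' -> ground_term (plug K t) -> ty_of t = ty_of t' ->
  ggt (plug K t) (plug K t').
Proof.
move=> [gt_t gt' tt'] gK tyE; have [gK' _] := ground_plug gK gt' tyE.
by split=> //; apply: (so_ctx gt_simpl) => //; apply: ground_wt.
Qed.

Lemma plug_le K t : ground_term (plug K t) -> le_of ggt t (plug K t).
Proof.
move=> gK; case KE: K => [|f us K' vs]; [by left | right].
rewrite -KE; split=> //; first exact: ground_plug_inv gK.
by apply: (so_subterm gt_simpl) => //; [rewrite KE | exact: ground_wt].
Qed.

Lemma ggt_arg f ts u : ground_term (App f ts) -> u \in ts -> ggt (App f ts) u.
Proof.
move=> gA /path.splitPr tsE; case: tsE gA => us vs gA.
split=> //; first exact: (@ground_plug_inv _ (CApp f us (Hole S) vs)).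
exact: (so_subterm gt_simpl (K := CApp f us (Hole S) vs)) (ground_wt gA).
Qed.

Lemma le_ggt_trans s t u : le_of ggt s t -> ggt u t -> ggt u s.
Proof. by move=> [-> //|ts] ut; apply: ggt_trans ts. Qed.

Lemma ggt_le_trans s t u : ggt t s -> le_of ggt t u -> ggt u s.
Proof. by move=> ts [<- //|ut]; apply: ggt_trans ts. Qed.

Lemma tle_trans s t u : le_of ggt s t -> le_of ggt t u -> le_of ggt s u.
Proof. by move=> [-> //|ts] tu; right; apply: ggt_le_trans tu. Qed.

Lemma le_App (A : eqType) f (g h : A -> term S) (r : seq A) :
  ground_term (App f (map h r)) ->
  (forall a, a \in r -> [/\ ground_term (g a), ty_of (g a) = ty_of (h a)
                          & le_of ggt (g a) (h a)]) ->
  ground_term (App f (map g r)) /\ le_of ggt (App f (map g r)) (App f (map h r)).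
Proof.
(* [p] holds the arguments already replaced, so that each single replacement takes place in a
   context. *)
rewrite -[map g r]cat0s -[map h r]cat0s; move: [::] => p.
elim: r p => [|a r IH] p gA hr; first by split=> //; left.
have [ga tya lea] := hr _ (mem_head _ _).
have [gA' _] := @ground_plug _ (CApp f p (Hole S) (map h r)) _ _ gA ga (esym tya).
have le1 : le_of ggt (App f (p ++ g a :: map h r)) (App f (p ++ h a :: map h r)).
  case: lea => [->|lea]; [by left | right].
  exact: (@ggt_plug (CApp f p (Hole S) (map h r))).
have [|b br|gA2 le2] := IH (rcons p (g a)).
- by rewrite cat_rcons.
- by apply: hr; rewrite inE br orbT.
by rewrite !cat_rcons in gA2 le2; split=> //; apply: tle_trans le1.
Qed.

Lemma le_tsubst theta theta' t : ground_subst theta -> ground_subst theta' ->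
  (forall x, le_of ggt (theta' x) (theta x)) -> wt t ->
  le_of ggt (tsubst theta' t) (tsubst theta t).
Proof.
move=> gth gth' h; elim/term_mem_ind: t => [x _|f ts IH wA]; first exact: h.
have gA := ground_tsubst gth wA; have gA' := ground_tsubst gth' wA.
move/andP: wA => [/allP wts _].
apply: (le_App gA _).2 => t tts; split; first exact: ground_tsubst (wts _ tts).
- by rewrite !ty_tsubst //; apply: ground_subst_wt.
- exact: IH (wts _ tts).
Qed.

Lemma lgt_trans l1 l2 l3 : lgt ggt l1 l2 -> lgt ggt l2 l3 -> lgt ggt l1 l3.
Proof. exact: mulgt_trans ggt_trans _ _ _. Qed.

Lemma lgt_wf : well_founded (fun l' l => lgt ggt l l').
Proof. exact: wf_inverse_image (mulgt_wf ggt_wf). Qed.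

Lemma lgt_irr l : ~ lgt ggt l l.
Proof. exact: wf_irrefl lgt_wf l. Qed.

Lemma cgt_trans C1 C2 C3 : cgt ggt C1 C2 -> cgt ggt C2 C3 -> cgt ggt C1 C3.
Proof. exact: mulgt_trans lgt_trans _ _ _. Qed.

Lemma cgt_wf : well_founded (fun C' C => cgt ggt C C').
Proof. exact: mulgt_wf lgt_wf. Qed.

Lemma cgt_irr C : ~ cgt ggt C C.
Proof. exact: wf_irrefl cgt_wf C. Qed.

(** The multisets of positive and negative literals have sizes 2 and 4, which separates the
    polarities. *)
Lemma lit_mset_inj l l' : ground_lit l -> ground_lit l' ->
  lit_mset l = lit_mset l' -> l = l'.
Proof.
move=> [s [t [-> _ _ _]]] [s' [t' [-> _ _ _]]].
rewrite /lit_mset /=; case: l.1; case: l'.1 => /= E; rewrite /lit.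
- by rewrite E.
- by move: (congr1 (fun A : {mset _} => \sum_(x <- A) 1) E); rewrite !mset_sumE !enum_msetn !big_seq1.
- by move: (congr1 (fun A : {mset _} => \sum_(x <- A) 1) E); rewrite !mset_sumE !enum_msetn !big_seq1.
- by congr pair; apply/msetP => x; move/msetP/(_ x): E; rewrite !msetE2; lia.
Qed.

Lemma lgt_total l l' : ground_lit l -> ground_lit l' ->
  [\/ l = l', lgt ggt l l' | lgt ggt l' l].
Proof.
move=> gl gl'; have [||x y|E|h|h] := @mulgt_total _ ggt _ _ (lit_mset l) (lit_mset l').
- exact: ggt_trans.
- exact: ggt_irr.
- rewrite !in_msetD !mem_lit_mset => xl yl; apply: ggt_total.
    by case/orP: xl; apply: ground_lit_mem.
  by case/orP: yl; apply: ground_lit_mem.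
- by constructor 1; apply: lit_mset_inj.
- by constructor 2.
- by constructor 3.
Qed.

Lemma cgt_total C D : ground_clause C -> ground_clause D ->
  [\/ C = D, cgt ggt C D | cgt ggt D C].
Proof.
move=> /ground_clauseP gC /ground_clauseP gD.
apply: mulgt_total lgt_trans lgt_irr _ _ _ => x y; rewrite !in_msetD => xl yl.
apply: lgt_total; first by case/orP: xl => [/gC|/gD].
by case/orP: yl => [/gC|/gD].
Qed.

Lemma lgt_ground l l' : ground_lit l -> ground_lit l' -> lgt gt l l' -> lgt ggt l l'.
Proof.
move=> gl gl'; apply: mulgt_sub => x y; rewrite !mem_lit_mset => xl yl xy.
by split=> //; [apply: ground_lit_mem xl | apply: ground_lit_mem yl].
Qed.

Lemma lgt_ggt l l' : lgt ggt l l' -> lgt gt l l'.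
Proof. by apply: mulgt_sub => x y _ _ []. Qed.

Lemma cgt_ground C D : ground_clause C -> ground_clause D -> cgt gt C D -> cgt ggt C D.
Proof.
move=> /ground_clauseP gC /ground_clauseP gD; apply: mulgt_sub => x y /gC gx /gD gy.
exact: lgt_ground.
Qed.

Lemma cgt_ggt C D : cgt ggt C D -> cgt gt C D.
Proof. by apply: mulgt_sub => x y _ _; apply: lgt_ggt. Qed.

Lemma lgt_lsubst theta l l' : wt_subst theta -> wf_literal l -> wf_literal l' ->
  lgt gt l l' -> lgt gt (lsubst theta l) (lsubst theta l').
Proof.
move=> wth wl wl'; rewrite /lgt !lit_mset_lsubst; apply: mulgt_mmap => x y.
rewrite !mem_lit_mset => xl yl; apply: (so_subst gt_simpl) => //.
  exact: wf_literal_mem xl.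
exact: wf_literal_mem yl.
Qed.

Lemma cgt_csubst theta C D : wt_subst theta -> wf_clause C -> wf_clause D ->
  cgt gt C D -> cgt gt (csubst theta C) (csubst theta D).
Proof.
move=> wth wC wD; apply: mulgt_mmap => x y /wC wx /wD wy; exact: lgt_lsubst.
Qed.

Lemma lgt_lt_sides b b' s s' t t' : ggt s t -> ggt s t' -> lgt ggt (lit b s s') (lit b' t t').
Proof.
move=> st st'; apply: mulgt_dominated.
  apply/negP => /eqP E; have : s \in lit_mset (lit b s s') by rewrite mem_lit_mset mem_lit eqxx.
  by rewrite E in_mset0.
move=> y; rewrite mem_lit_mset mem_lit => yt.
exists s; first by rewrite mem_lit_mset mem_lit eqxx.
by case/orP: yt => /eqP ->.
Qed.

Lemma lgt_neg_pos s s' t' : ggt s t' -> lgt ggt (s ≉ s') (s ≈ t').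
Proof.
(* Of the two copies of [s] one stays as the left side of [s ≈ t']; the other dominates [t']. *)
move=> st'; exists ([mset s] `+` [mset s'] `+` [mset s']), [mset t']; split.
- by apply/negP => /eqP/msetP/(_ s); rewrite !msetE eqxx.
- by apply/msubsetP => x; rewrite /lit_mset /= !msetE; lia.
- by apply/msetP => x; rewrite /lit_mset /= !msetE; lia.
- by move=> y; rewrite in_mset1 => /eqP ->; exists s => //; rewrite !in_msetD mset11.
Qed.

Lemma lgt_mem_le l s t u : ggt s t -> le_of (lgt ggt) l (s ≈ t) -> u \in l.2 -> le_of ggt u s.
Proof.
have memst v : ggt s t -> v \in lit_mset (s ≈ t) -> le_of ggt v s.
  by move=> st; rewrite mem_lit_mset mem_lit => /orP[]/eqP ->; [left|right].
move=> st [->|[X [Y [_ XM E XY]]]]; rewrite -mem_lit_mset; first exact: memst.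
rewrite E in_msetD => /orP[uM|/XY[x xX xu]].
  by apply: memst => //; apply: (msubset_subset _ uM); apply: msubsetDl.
right; apply: ggt_le_trans xu _; apply: memst => //; exact: msubset_subset xX.
Qed.

End GroundOrder.

(** * Term interpretations given by a system of ground rules *)

Section GuardedRecursion.
Context (T A : Type) (r : T -> T -> Prop) (rwf : well_founded (fun y x => r x y)).
Context (F : T -> (T -> A) -> A) (d : T -> A).

(** Recursive calls outside the ordering return a default, so that [F] receives a total function and
    carries no proofs. *)
Definition guard (g : T -> A) (x y : T) : A :=
  match excluded_middle_informative (r x y) with left _ => g y | right _ => d y end.

Definition wfrec : T -> A :=
  Fix rwf (fun _ => A) (fun x rec => F x (fun y =>
    match excluded_middle_informative (r x y) with
    | left h => rec y h
    | right _ => d y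
    end)).

Lemma wfrecE x : wfrec x = F x (guard wfrec x).
Proof.
rewrite {1}/wfrec Fix_eq; [reflexivity|].
move=> y f g fg; congr F.
by apply: functional_extensionality => z; case: excluded_middle_informative.
Qed.

Lemma guard_lt (g : T -> A) x y : r x y -> guard g x y = g y.
Proof. by rewrite /guard; case: excluded_middle_informative. Qed.

End GuardedRecursion.

Section TermModel.
Context (S : signature) (gt : term S -> term S -> Prop).
Hypothesis gt_simpl : simplification_order gt.
Implicit Types (s t u : term S) (l : literal S) (C D : clause S).
Implicit Types (R : term S -> option (term S)).
Local Notation ggt := (ggt gt).

Definition decreasing_rules R : Prop :=
  forall u u', R u = Some u' -> ggt u u' /\ ty_of u = ty_of u'.

(* When no left-hand side is reducible below its root, this is the normal form
   for the convergent system [R]. *)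
Definition nf R : term S -> term S :=
  wfrec (ggt_wf gt_simpl) (fun t rec =>
    if t is App f ts then
      let u := App f (map rec ts) in if R u is Some u' then rec u' else u
    else t) id.

(** On normal arguments this is also the interpretation of [f] in [term_model]. *)
Definition nf_head R (f : fsym S) (us : seq (term S)) : term S :=
  if R (App f us) is Some u' then nf R u' else App f us.

(** The bound and the equation need each other: the recursive call on a reduct is within the guard
    only because normalizing the arguments does not increase the term. *)
Lemma nf_props R : decreasing_rules R -> forall t, ground_term t ->
  [/\ ground_term (nf R t), ty_of (nf R t) = ty_of t, le_of ggt (nf R t) t
    & forall f ts, t = App f ts -> nf R t = nf_head R f (map (nf R) ts) /\
        ground_term (App f (map (nf R) ts)) /\ le_of ggt (App f (map (nf R) ts)) t].
Proof.
move=> Rdec t; elim/(well_founded_induction (ggt_wf gt_simpl)): t => t IH.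
case: t IH => [x _ /groundP[_ /(_ x)]|f ts IH gA]; first by rewrite mem_head.
have argE : map (guard ggt id (nf R) (App f ts)) ts = map (nf R) ts.
  by apply/eq_in_map => u uts; apply: guard_lt; apply: ggt_arg.
have [gts _] := ground_AppP _ _ gA.
have [gw lew] : ground_term (App f (map (nf R) ts)) /\
    le_of ggt (App f (map (nf R) ts)) (App f ts).
  rewrite -{3}(map_id ts); apply: le_App; rewrite ?map_id // => u uts.
  by have [] := IH u (ggt_arg gt_simpl gA uts) (gts _ uts).
have nfE : nf R (App f ts) = nf_head R f (map (nf R) ts).
  rewrite {1}/nf wfrecE -/(nf R) /= argE /nf_head.
  case Rw: (R _) => [w'|//]; apply: guard_lt.
  by have [ww' _] := Rdec _ _ Rw; apply: ggt_le_trans lew.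
split=> [||| f' ts' [<- <-] //]; rewrite nfE /nf_head; case Rw: (R _) => [w'|//].
- have [ww' _] := Rdec _ _ Rw.
  by have [] := IH w' (ggt_le_trans gt_simpl ww' lew) => //; case: ww'.
- have [ww' tyw] := Rdec _ _ Rw.
  by have [|_ ->//] := IH w' (ggt_le_trans gt_simpl ww' lew); case: ww'.
- have [ww' _] := Rdec _ _ Rw; have ltw := ggt_le_trans gt_simpl ww' lew.
  have [|_ _ le' _] := IH w' ltw; first by case: ww'.
  by apply: tle_trans le' _ => //; right.
Qed.

Section Rules.
Context (R : term S -> option (term S)) (Rdec : decreasing_rules R).

Lemma nf_le t : ground_term t -> le_of ggt (nf R t) t.
Proof. by case/(nf_props Rdec). Qed.

Lemma nf_App f ts : ground_term (App f ts) ->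
  nf R (App f ts) = nf_head R f (map (nf R) ts).
Proof. by case/(nf_props Rdec) => _ _ _ /(_ _ _ erefl)[]. Qed.

(** With normal arguments the root rule is the first one to fire; this is why candidates require
    irreducible arguments. *)
Lemma nf_rule t t' : ground_term t -> R t = Some t' ->
  (forall f ts u, t = App f ts -> u \in ts -> nf R u = u) -> nf R t = nf R t'.
Proof.
case: t => [x /groundP[_ /(_ x)]|f ts gA Rt tsP]; first by rewrite mem_head.
rewrite nf_App // /nf_head (_ : map _ ts = ts) ?Rt //.
by rewrite -[RHS]map_id; apply/eq_in_map => u; apply: tsP.
Qed.

Lemma nf_reducible t : ground_term t -> nf R t <> t ->
  exists K u u', t = plug K u /\ R u = Some u'.
Proof.
elim/term_mem_ind: t => [x /groundP[_ /(_ x)]|f ts IH gA nred]; first by rewrite mem_head.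
have [gts _] := ground_AppP _ _ gA.
have [h|h] := classic (forall u, u \in ts -> nf R u = u).
  have E : map (nf R) ts = ts by rewrite -[RHS]map_id; apply/eq_in_map.
  case Rt: (R (App f ts)) => [t'|]; first by exists (Hole S), (App f ts), t'.
  by case: nred; rewrite nf_App // /nf_head E Rt.
have [u nu'] := not_all_ex_not (term S) _ h; have [uts nu] := imply_to_and _ _ nu'.
have [K [w [w' [uE Rw]]]] := IH u uts (gts _ uts) nu.
move/path.splitPr: uts => tsE; case: tsE => us vs.
by exists (CApp f us K vs), w, w'; rewrite uE.
Qed.

Lemma nf_plug K t t' : ground_term (plug K t) -> ground_term t' ->
  ty_of t = ty_of t' -> nf R t = nf R t' -> nf R (plug K t) = nf R (plug K t').
Proof.
move=> + gt' tyE vE; elim: K => //= f us K IH vs gA.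
have [gA' _] := @ground_plug _ (CApp f us K vs) _ _ gA gt' tyE.
rewrite !nf_App // !map_cat /= IH //.
by case/ground_AppP: gA => + _; apply; rewrite mem_cat mem_head orbT.
Qed.

End Rules.

(** Normalizing [t] consults rules only at terms up to [t]. Hence the truth of a literal, once the
    rules up to its larger side are fixed, no longer changes. *)
Lemma nf_local R1 R2 t : decreasing_rules R1 -> decreasing_rules R2 -> ground_term t ->
  (forall u, ground_term u -> le_of ggt u t -> R1 u = R2 u) -> nf R1 t = nf R2 t.
Proof.
move=> dec1 dec2; elim/(well_founded_induction (ggt_wf gt_simpl)): t => t IH.
case: t IH => [x _ /groundP[_ /(_ x)]|f ts IH gA R12]; first by rewrite mem_head.
have [gts _] := ground_AppP _ _ gA.
have [_ _ _ /(_ _ _ erefl)[-> [gw lew]]] := nf_props dec1 gA.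
rewrite (nf_App dec2) //.
have E : map (nf R1) ts = map (nf R2) ts.
  apply/eq_in_map => u uts; have ltu := ggt_arg gt_simpl gA uts.
  apply: IH (gts _ uts) _ => // w gw' lew'; apply: R12 => //; right.
  exact: le_ggt_trans lew' ltu.
rewrite /nf_head -E -R12 //; case Rw: (R1 _) => [w'|//].
have [ww' _] := dec1 _ _ Rw; have ltw := ggt_le_trans gt_simpl ww' lew.
apply: IH => //; first by case: ww'.
by move=> v gv lev; apply: R12 => //; right; apply: le_ggt_trans ltw.
Qed.

Definition true_lit R l : Prop :=
  exists s t, l = lit l.1 s t /\
    (if l.1 then nf R s = nf R t else nf R s <> nf R t).

Definition true_clause R C : Prop := exists2 l, l \in C & true_lit R l.

Lemma true_lit_lit R b s t :
  true_lit R (lit b s t) <-> (if b then nf R s = nf R t else nf R s <> nf R t).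
Proof.
split=> [[s' [t' [/lit_inj[_ [][-> ->]] //=]]]|h]; last by exists s, t.
by case: b => // h /esym.
Qed.

Lemma holds_lit_lit (I : interp S) (v : var S -> carrier I) b s t :
  holds_lit v (lit b s t) <-> (if b then eval v s = eval v t else eval v s <> eval v t).
Proof.
split=> [[s' [t' [/lit_inj[_ [][-> ->]] //=]]]|h]; last by exists s, t.
by case: b => // h /esym.
Qed.

Section Interpretation.
Hypothesis ty_inhabited : forall tau : ty S, exists2 t : term S, ground_term t & ty_of t = tau.
Context (R : term S -> option (term S)) (Rdec : decreasing_rules R).

Definition nf_dom (tau : ty S) (a : term S) : Prop :=
  exists t, [/\ ground_term t, ty_of t = tau & nf R t = a].

Lemma nf_dom_nonempty tau : exists a, nf_dom tau a.
Proof. by have [t gt_t tyt] := ty_inhabited tau; exists (nf R t), t. Qed.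

Lemma nf_head_dom f args : List.Forall2 nf_dom (arg_tys f) args ->
  nf_dom (res_ty f) (nf_head R f args).
Proof.
move=> h; suff [ts [gts tyts vts]] : exists ts, [/\ forall t, t \in ts -> ground_term t,
    map (@ty_of S) ts = arg_tys f & map (nf R) ts = args].
  have gA : ground_term (App f ts) by apply/ground_AppP.
  by exists (App f ts); split=> //; rewrite nf_App // vts.
elim: h => [|tau a taus args' [t [gt_t tyt vt]] _ [ts [gts tyts vts]]]; first by exists [::].
exists (t :: ts); split=> /=; rewrite ?tyt ?tyts ?vt ?vts //.
by move=> u; rewrite inE => /orP[/eqP ->|/gts].
Qed.

Definition term_model : interp S := Interp nf_dom_nonempty nf_head_dom.

Lemma eval_term_model (v : var S -> carrier term_model) theta t :
  ground_subst theta -> (forall x, v x = nf R (theta x)) -> wt t ->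
  eval v t = nf R (tsubst theta t).
Proof.
move=> gth vE; elim/term_mem_ind: t => [x _|f ts IH wA]; first exact: vE.
have gA := ground_tsubst gth wA; rewrite [tsubst _ _]/= in gA *.
rewrite nf_App //= -map_comp; congr (nf_head R f _); apply/eq_in_map => t tts.
by apply: IH => //; case/andP: wA => /allP + _; apply.
Qed.

Lemma valuation_subst (v : var S -> carrier term_model) : (forall x, dom x.1 (v x)) ->
  exists2 theta, ground_subst theta & forall x, v x = nf R (theta x).
Proof.
move=> hv; have [theta h] := choice (fun (x : var S) t =>
  [/\ ground_term t, ty_of t = x.1 & nf R t = v x]) hv.
by exists theta => x; case: (h x).
Qed.

Lemma term_model_valuation : exists v : var S -> carrier term_model, forall x, dom x.1 (v x).
Proof.
by apply: (choice (fun (x : var S) a => nf_dom x.1 a)) => x; apply: nf_dom_nonempty.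
Qed.

Lemma models_ground C : ground_clause C -> models term_model C <-> true_clause R C.
Proof.
move=> /ground_clauseP gC.
have litE v theta l : ground_subst theta -> (forall x, v x = nf R (theta x)) -> l \in C ->
    @holds_lit _ term_model v l <-> true_lit R l.
  move=> gth vE /gC[s [t [-> gs gt_t _]]]; rewrite holds_lit_lit true_lit_lit.
  by rewrite !(eval_term_model gth vE) ?ground_tsubst_id //; apply: ground_wt.
split=> [h|[l lC tl] v hv]; last first.
  by have [theta gth vE] := valuation_subst hv; exists l => //; apply/litE.
have [v hv] := term_model_valuation; have [theta gth vE] := valuation_subst hv.
by have [l lC hl] := h v hv; exists l => //; apply/(litE _ _ _ gth vE).
Qed.

Lemma models_instances C : wf_clause C ->
  (forall theta, ground_subst theta -> true_clause R (csubst theta C)) -> models term_model C.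
Proof.
move=> wfC h v hv; have [theta gth vE] := valuation_subst hv.
have [_ /mmapP[l lC ->] tl] := h _ gth; exists l => //.
have [s [t [lE ws wt_t _]]] := wfC _ lC; rewrite lE in tl *.
move: tl; rewrite lsubst_lit true_lit_lit holds_lit_lit.
by rewrite !(eval_term_model gth vE).
Qed.

Lemma entailed_true (Ds : seq (clause S)) C : entails (fun D => D \in Ds) C ->
  ground_clause C -> (forall D, D \in Ds -> ground_clause D /\ true_clause R D) ->
  true_clause R C.
Proof.
move=> ent gC h; apply/models_ground => //; apply: ent => D /h[gD tD].
exact/models_ground.
Qed.

End Interpretation.

End TermModel.

(** * Refutational completeness of ground superposition *)

Section GroundRules.
Context (S : signature) (gt : term S -> term S -> Prop) (gsel : selection S).
Implicit Types (s t u v : term S) (C D E : clause S).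

(** The constructors of [GInf] with the premises given by equations, so that a clause can stay a
    variable and be decomposed in several ways. *)
Lemma GInf_sup D C D' C' t t' K b s' :
  D = D' `+` [mset t ≈ t'] -> C = C' `+` [mset lit b (plug K t) s'] ->
  ground_clause D -> ground_clause C ->
  strictly_eligible gt (gsel D) (@id_subst S) (t ≈ t') D ->
  sup_eligible gt (gsel C) (@id_subst S) (lit b (plug K t) s') C ->
  gt t t' -> gt (plug K t) s' -> cgt gt C D ->
  GInf gt gsel (GInference [:: D; C] (C' `+` D' `+` [mset lit b (plug K t') s'])).
Proof. by move=> -> ->; apply: GSup. Qed.

Lemma GInf_eqfact C C' u v v' : C = C' `+` [mset u ≈ v'] `+` [mset u ≈ v] ->
  ground_clause C -> eligible gt (gsel C) (@id_subst S) (u ≈ v) C -> gt u v -> gt u v' ->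
  GInf gt gsel (GInference [:: C] (C' `+` [mset v ≉ v'] `+` [mset u ≈ v])).
Proof. by move=> ->; apply: GEqFact. Qed.

Lemma GInf_eqres C C' s : C = C' `+` [mset s ≉ s] ->
  ground_clause C -> eligible gt (gsel C) (@id_subst S) (s ≉ s) C ->
  GInf gt gsel (GInference [:: C] C').
Proof. by move=> ->; apply: GEqRes. Qed.

End GroundRules.

Section GroundCompleteness.
Context (S : signature) (gt : term S -> term S -> Prop).
Hypothesis gt_simpl : simplification_order gt.
Hypothesis ty_inhabited : forall tau : ty S, exists2 t : term S, ground_term t & ty_of t = tau.
Context (gsel : selection S) (M : clause_set S).
Hypothesis gsel_fun : selection_function_on (@ground_clause S) gsel.
Hypothesis M_ground : forall C, M C -> ground_clause C.
Hypothesis M_bot : ~ M (bot S).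

Definition ground_saturated : Prop :=
  forall i, GInf gt gsel i -> (forall C, C \in gprems i -> M C) ->
    (exists2 C, C \in gprems i & GRedCl gt M C) \/
    entailed_below gt M (max_prem i) (gconcl i).

Hypothesis M_saturated : ground_saturated.
Implicit Types (s t u : term S) (l : literal S) (C D : clause S).
Local Notation ggt := (ggt gt).
Local Notation nf := (nf gt_simpl).
Local Notation true_clause := (true_clause gt_simpl).
Local Notation true_lit := (true_lit gt_simpl).

Definition add_rule (R : term S -> option (term S)) t t' u : option (term S) :=
  if u == t then Some t' else R u.

(* Only non-redundant clauses may produce rules, so that redundancy of an
   inference always comes from its conclusion. *)
Definition candidate (R : term S -> option (term S)) t D t' : Prop :=
  [/\ M D, ~ GRedCl gt M D, gsel D = fset0, (t ≈ t') \in D & ggt t t'] /\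
  [/\ forall l, l \in D `\ (t ≈ t') -> lgt ggt (t ≈ t') l,
      forall f ts u, t = App f ts -> u \in ts -> nf R u = u
    & ~ true_clause (add_rule R t t') (D `\ (t ≈ t'))].

Definition minimal_candidate R t (p : clause S * term S) : Prop :=
  candidate R t p.1 p.2 /\
  forall q : clause S * term S, candidate R t q.1 q.2 -> ~ cgt ggt p.1 q.1.

Definition rules : term S -> option (term S) :=
  wfrec (ggt_wf gt_simpl) (fun t R =>
    match excluded_middle_informative (exists p, minimal_candidate R t p) with
    | left h => Some (proj1_sig (constructive_indefinite_description _ h)).2
    | right _ => None
    end) (fun _ => None).

Definition rules_below t : term S -> option (term S) :=
  guard ggt (fun _ => None) rules t.

Lemma rules_minimal t t' : rules t = Some t' ->
  exists D, minimal_candidate (rules_below t) t (D, t').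
Proof.
rewrite /rules wfrecE -/rules; case: excluded_middle_informative => // h.
case: constructive_indefinite_description => [[D t'']] /= hD [<-]; by exists D.
Qed.

Lemma rules_candidate t D t' : candidate (rules_below t) t D t' ->
  exists t'', rules t = Some t''.
Proof.
rewrite /rules wfrecE -/rules => cD.
case: excluded_middle_informative => [h|]; first by eexists.
case; elim/(well_founded_induction (cgt_wf gt_simpl)): D t' cD => D IH t' cD.
have [[q [cq Dq]]|h] := classic (exists q, candidate (rules_below t) t q.1 q.2 /\ cgt ggt D q.1).
  exact: IH Dq _ cq.
exists (D, t'); split=> // q cq Dq; apply: h; by exists q.
Qed.

Lemma candidate_ty R t D t' : candidate R t D t' -> ty_of t = ty_of t'.
Proof.
move=> [[/M_ground/ground_clauseP gD _ _ /gD] + _ _].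
by case/ground_lit_lit.
Qed.

Lemma rules_decreasing : decreasing_rules gt rules.
Proof.
move=> t t' /rules_minimal[D [cD _]]; split; last exact: candidate_ty cD.
by case: cD => [[]].
Qed.

Lemma rules_belowE t u : ggt t u -> rules_below t u = rules u.
Proof. exact: guard_lt. Qed.

Lemma rules_below_decreasing t : decreasing_rules gt (rules_below t).
Proof.
move=> u u'; rewrite /rules_below /guard; case: excluded_middle_informative => // _.
exact: rules_decreasing.
Qed.

Lemma add_rule_decreasing R t t' : decreasing_rules gt R -> ggt t t' -> ty_of t = ty_of t' ->
  decreasing_rules gt (add_rule R t t').
Proof.
move=> Rdec tt' ty_t u u'; rewrite /add_rule; case: eqP => [-> [<-]|_ /Rdec] //.
Qed.

Lemma nf_below t u : ggt t u -> nf (rules_below t) u = nf rules u.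
Proof.
move=> tu; apply: nf_local => //; [exact: rules_below_decreasing | exact: rules_decreasing | by case: tu |].
by move=> w _ wu; apply: rules_belowE; apply: le_ggt_trans tu.
Qed.

Lemma nf_add_rule_below t t' u : ggt t t' -> ty_of t = ty_of t' -> ggt t u ->
  nf (add_rule (rules_below t) t t') u = nf rules u.
Proof.
move=> tt' ty_t tu; apply: nf_local => //.
- exact/add_rule_decreasing/ty_t/tt'/rules_below_decreasing.
- exact: rules_decreasing.
- by case: tu.
move=> w _ wu; have tw := le_ggt_trans gt_simpl wu tu; rewrite /add_rule.
by case: eqP => [wt|_]; [case: (@ggt_irr _ _ gt_simpl t); rewrite -{2}wt | apply: rules_belowE].
Qed.

(** In contrast to [nf_add_rule_below], [t] itself is covered, because the added rule is the one
    actually chosen. *)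
Lemma nf_add_rule t t' u : rules t = Some t' -> ground_term u -> le_of ggt u t ->
  nf (add_rule (rules_below t) t t') u = nf rules u.
Proof.
move=> Rt gu ut; have [tt' ty_t] := rules_decreasing Rt; apply: nf_local => //.
- exact/add_rule_decreasing/ty_t/tt'/rules_below_decreasing.
- exact: rules_decreasing.
move=> w _ wu; rewrite /add_rule; case: eqP => [-> //|wt]; apply: rules_belowE.
by have [//|] := tle_trans gt_simpl wu ut.
Qed.

Lemma id_lsubst l : lsubst (@id_subst S) l = l. Proof. exact: lsubst_id. Qed.
Lemma id_csubst C : csubst (@id_subst S) C = C. Proof. exact: csubst_id. Qed.

(** All literals of the producing clause are at most [t ≈ t'], so their terms are at most [t] and
    rules for larger terms cannot make the remaining literals true. *)
Lemma rules_production t t' : rules t = Some t' -> exists D',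
  let D := D' `+` [mset t ≈ t'] in
  [/\ M D, ~ GRedCl gt M D, strictly_eligible gt (gsel D) (@id_subst S) (t ≈ t') D
    & forall l, l \in D -> le_of (lgt ggt) l (t ≈ t')] /\
  [/\ ~ true_clause rules D', nf rules t = nf rules t'
    & forall C s', candidate (rules_below t) t C s' -> ~ cgt ggt D C].
Proof.
move=> Rt; have [D [/= cD Dmin]] := rules_minimal Rt.
have [[MD nD selD tD tt'] [Dmax argsP D'F]] := cD.
have [_ ty_t] := rules_decreasing Rt.
have /ground_clauseP gD := M_ground MD.
have Dle l : l \in D -> le_of (lgt ggt) l (t ≈ t').
  by rewrite (msetB1D tD) in_msetD1r => /orP[/Dmax|/eqP]; [right|left].
exists (D `\ (t ≈ t')); rewrite -msetB1D //=; split; split=> //.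
- right; split; first exact: selD.
  rewrite id_lsubst id_csubst => l lD.
  have gl : ground_lit l by apply: gD; apply: (msubset_subset (msubsetDl _ _) lD).
  have lt_l := Dmax _ lD => -[E|lt].
    by apply: (lgt_irr gt_simpl (l := l)); rewrite -{1}E.
  apply: (lgt_irr gt_simpl (l := l)); apply: lgt_trans lt_l => //.
  exact: lgt_ground (gD _ tD) lt.
- move=> [l lD tl]; apply: D'F; exists l => //.
  have lD0 : l \in D by apply: (msubset_subset (msubsetDl _ _) lD).
  have lle := Dle _ lD0; have gl := gD _ lD0.
  have vE u : u \in (l : literal S).2 -> nf (add_rule (rules_below t) t t') u = nf rules u.
    by move=> ul; apply: nf_add_rule => //; [exact: ground_lit_mem ul | exact: lgt_mem_le tt' lle ul].
  case: gl => s [s' [lE _ _ _]]; rewrite lE in tl vE *.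
  by move: tl; rewrite !true_lit_lit !vE // mem_lit eqxx ?orbT.
- apply: nf_rule => //; first exact: rules_decreasing.
    by case: tt'.
  move=> f ts u tE uts; rewrite -{2}(argsP _ _ _ tE uts) nf_below //.
  by rewrite tE; apply: ggt_arg => //; rewrite -tE; case: tt'.
- by move=> C s' cC; apply: (Dmin (C, s')).
Qed.

(** * The minimal counterexample *)

Section MinimalCounterexample.
Context (C : clause S) (MC : M C) (CF : ~ true_clause rules C).
Hypothesis IH : forall D, M D -> cgt ggt C D -> true_clause rules D.

Let gC : ground_clause C := M_ground MC.

Lemma entailed_below_true E : ground_clause E -> entailed_below gt M C E -> true_clause rules E.
Proof.
move=> gE [Ds DsP ent]; apply: (entailed_true ty_inhabited rules_decreasing ent) => // D DDs.
have [MD CD] := DsP _ DDs; split; first exact: M_ground.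
exact/IH/cgt_ground/CD/M_ground/MD.
Qed.

Lemma counterexample_nonredundant : ~ GRedCl gt M C.
Proof. by move=> [_ h]; apply: CF; apply: entailed_below_true. Qed.

Lemma unary_conclusion_true E : ground_clause E -> GInf gt gsel (GInference [:: C] E) ->
  true_clause rules E.
Proof.
move=> gE hi; have [|[D]|h] := M_saturated hi.
- by move=> D /=; rewrite inE => /eqP ->.
- by rewrite inE => /eqP -> /counterexample_nonredundant.
- exact: entailed_below_true.
Qed.

Lemma counterexample_eqres C' s : C = C' `+` [mset s ≉ s] ->
  ~ eligible gt (gsel C) (@id_subst S) (s ≉ s) C.
Proof.
move=> CE el; have gC' : ground_clause C' by move: gC; rewrite CE => /ground_clauseD[].
have [] := @unary_conclusion_true C' => //.
  exact: GInf_eqres CE gC el.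
by move=> l lC' tl; apply: CF; exists l => //; rewrite CE in_msetD lC'.
Qed.

(** With equal normal forms the new disequation would be false, while every other literal of the
    factoring conclusion is a literal of the false clause [C]. *)
Lemma counterexample_eqfact C' s s' w : C = C' `+` [mset s ≈ w] `+` [mset s ≈ s'] ->
  eligible gt (gsel C) (@id_subst S) (s ≈ s') C -> ggt s s' -> ggt s w ->
  nf rules s' <> nf rules w.
Proof.
move=> CE el ss' sw vE.
have [/ground_clauseD[gC' gw] gs] : ground_clause (C' `+` [mset s ≈ w]) /\ ground_clause [mset s ≈ s'].
  by apply: (proj1 (ground_clauseD _ _)); rewrite -CE.
have [||l] := @unary_conclusion_true (C' `+` [mset s' ≉ w] `+` [mset s ≈ s']).
- apply: (ground_clauseDI _ gs); apply: (ground_clauseDI gC').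
  move/ground_clause1/ground_lit_lit: gw => [_ gw tyw].
  move/ground_clause1/ground_lit_lit: gs => [_ gs' tys'].
  by apply/ground_clause1/ground_lit_lit; split=> //; rewrite -tys'.
- apply: (GInf_eqfact CE).
  + exact: gC.
  + exact: el.
  + by case: ss'.
  + by case: sw.
rewrite !in_msetD1r => /orP[/orP[lC' tl|/eqP -> /true_lit_lit //]|/eqP -> tl];
  apply: CF.
  by exists l => //; rewrite CE !in_msetD1r lC'.
by exists (s ≈ s') => //; rewrite CE !in_msetD1r eqxx orbT.
Qed.

(** The superposition conclusion would be true by redundancy, yet its literals from [C'] and [D']
    are false and the rewritten literal has the truth value of the original one. *)
Lemma counterexample_sup C' b K t t' s' D' :
  C = C' `+` [mset lit b (plug K t) s'] -> ggt t t' -> ty_of t = ty_of t' ->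
  M (D' `+` [mset t ≈ t']) -> ~ GRedCl gt M (D' `+` [mset t ≈ t']) ->
  strictly_eligible gt (gsel (D' `+` [mset t ≈ t'])) (@id_subst S) (t ≈ t') (D' `+` [mset t ≈ t']) ->
  ~ true_clause rules D' -> nf rules t = nf rules t' ->
  sup_eligible gt (gsel C) (@id_subst S) (lit b (plug K t) s') C ->
  ggt (plug K t) s' -> ~ cgt ggt C (D' `+` [mset t ≈ t']).
Proof.
move=> CE tt' ty_t MD nD elD D'F vE elC ss' CD.
set E := C' `+` D' `+` [mset lit b (plug K t') s'].
have [gC' /ground_clause1/ground_lit_lit[gK gs' tyK]] :
    ground_clause C' /\ ground_clause [mset lit b (plug K t) s'].
  by apply: (proj1 (ground_clauseD _ _)); rewrite -CE.
have [gD' _] : ground_clause D' /\ ground_clause [mset t ≈ t'].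
  exact: (proj1 (ground_clauseD _ _)) (M_ground MD).
have [_ gt' _] := tt'; have [gK' tyK'] := ground_plug gK gt' ty_t.
have gE : ground_clause E.
  apply: ground_clauseDI; first exact: ground_clauseDI.
  by apply/ground_clause1/ground_lit_lit; split=> //; rewrite -tyK'.
have hi : GInf gt gsel (GInference [:: D' `+` [mset t ≈ t']; C] E).
  apply: (GInf_sup (D' := D') erefl CE).
  - exact: M_ground MD.
  - exact: gC.
  - exact: elD.
  - exact: elC.
  - by case: tt'.
  - by case: ss'.
  - exact: cgt_ggt CD.
have [B|[B]|h] := M_saturated hi.
- by rewrite /= !inE => /orP[]/eqP ->.
- by rewrite /= !inE => /orP[]/eqP -> // /counterexample_nonredundant.
have [l] := entailed_below_true gE h.
rewrite in_msetD1r in_msetD => /orP[/orP[lC'|lD']|/eqP ->] tl.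
- by apply: CF; exists l => //; rewrite CE in_msetD1r lC'.
- by apply: D'F; exists l.
apply: CF; exists (lit b (plug K t) s'); first by rewrite CE in_msetD1r eqxx orbT.
move: tl; rewrite !true_lit_lit (nf_plug (rules_decreasing) gK gt' ty_t) //.
Qed.

(* A reducible side of an eligible literal is rewritten by a superposition
   inference with the clause that produced the rule. *)
Lemma counterexample_reduce C' b s s' : C = C' `+` [mset lit b s s'] ->
  sup_eligible gt (gsel C) (@id_subst S) (lit b s s') C -> ggt s s' ->
  forall K t t', s = plug K t -> rules t = Some t' ->
    ~ ((exists2 l, l \in C & lgt ggt l (t ≈ t')) \/
       (exists2 s'', t = s & candidate (rules_below s) s C s'')).
Proof.
move=> CE elC ss' K t t' sE Rt.
have [D' /= [[MD nD elD Dle] [D'F vE Dmin]]] := rules_production Rt.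
have [tt' ty_t] := rules_decreasing Rt.
have noCD : ~ cgt ggt C (D' `+` [mset t ≈ t']).
  by rewrite sE in CE elC ss'; apply: (counterexample_sup CE tt' ty_t MD nD elD D'F vE elC ss').
case=> [[l lC lt]|[s'' ts cC]]; apply: noCD.
  apply: mulgt_dominated => [|l' /Dle[->|lt']].
  - by apply: contraTneq lC => ->; rewrite in_mset0.
  - by exists l.
  - by exists l => //; apply: lgt_trans lt'.
rewrite -ts in cC.
(* Both clauses are candidates for the same term, so the producer is not above [C]; it differs from
   [C] because it is true. *)
case: (cgt_total gt_simpl (M_ground MD) gC) => [CD|/(Dmin _ _ cC) []|CD]; last exact: CD.
case: CF; rewrite -CD; exists (t ≈ t'); first by rewrite in_msetD1r eqxx orbT.
exact: (proj2 (true_lit_lit gt_simpl rules true t t')) vE.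
Qed.

(** A false disequation has sides with a common normal form: identical sides are resolved away,
    otherwise the larger side is reducible. *)
Lemma counterexample_negative l : l \in C -> l.1 = false ->
  ~ eligible gt (gsel C) (@id_subst S) l C.
Proof.
move=> lC l1 el; have /ground_clauseP gC0 := gC.
have [s [s' [lE gs gs' tyE]]] := gC0 _ lC; rewrite l1 in lE.
wlog ss' : s s' lE gs gs' tyE / le_of ggt s' s.
  move=> W; case: (ggt_total gt_simpl gs gs') => h.
  - by apply: (W s s') => //; left.
  - by apply: (W s s') => //; right.
  - by apply: (W s' s) => //; [rewrite lE lit_sym | right].
have CE : C = C `\ (s ≉ s') `+` [mset s ≉ s'] by rewrite -lE; apply: msetB1D.
have vE : nf rules s = nf rules s'.
  apply: NNPP => vne; apply: CF; exists l => //; rewrite lE.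
  exact: (proj2 (true_lit_lit gt_simpl rules false s s')) vne.
rewrite lE in el; case: ss' => [s'E|ss'].
  by rewrite s'E in CE el; apply: (counterexample_eqres CE el).
(* The normal form of [s] is that of [s'], hence at most [s'] and strictly below [s]. *)
have nred : nf rules s <> s.
  rewrite vE => E; apply: (@ggt_irr _ _ gt_simpl s); rewrite -{2}E.
  exact: le_ggt_trans (nf_le gt_simpl rules_decreasing gs') ss'.
have [K [t [t' [sE Rt]]]] := nf_reducible rules_decreasing gs nred.
apply: (counterexample_reduce CE el ss' sE Rt); left; exists l => //; rewrite lE.
have [tt' _] := rules_decreasing Rt.
(* The redex may be [s] itself: a disequation with side [s] still exceeds [s ≈ t']. *)
have := @plug_le _ _ gt_simpl K t; rewrite -sE => /(_ gs)[ts|st].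
  by rewrite ts in tt' *; apply: lgt_neg_pos.
by apply: lgt_lt_sides => //; apply: ggt_trans tt'.
Qed.

(** If no rule rewrites [s] strictly below its root, [C] meets all conditions of a candidate for
    [s]. Then a rule for [s] exists, its producer is not above [C], and superposition at the root
    contradicts minimality. *)
Lemma counterexample_positive l : l \in C -> l.1 = true -> gsel C = fset0 ->
  ~ (forall l', l' \in C -> ~ lgt ggt l' l).
Proof.
move=> lC l1 selC lmax; have /ground_clauseP gC0 := gC.
have [s [s' [lE gs gs' tyE]]] := gC0 _ lC; rewrite l1 in lE.
wlog ss' : s s' lE gs gs' tyE / le_of ggt s' s.
  move=> W; case: (ggt_total gt_simpl gs gs') => h.
  - by apply: (W s s') => //; left.
  - by apply: (W s s') => //; right.
  - by apply: (W s' s) => //; [rewrite lE lit_sym | right].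
have lF : nf rules s <> nf rules s'.
  move=> vE; apply: CF; exists l => //; rewrite lE.
  exact: (proj2 (true_lit_lit gt_simpl rules true s s')) vE.
case: ss' => [s'E|ss']; first by rewrite s'E in lF.
have CE : C = C `\ (s ≈ s') `+` [mset s ≈ s'] by rewrite -lE; apply: msetB1D.
have lle l' : l' \in C -> le_of (lgt ggt) l' (s ≈ s').
  move=> l'C; rewrite -lE; case: (lgt_total gt_simpl (gC0 _ l'C) (gC0 _ lC)) => h.
  - by left. - by case: (lmax _ l'C). - by right.
have el : eligible gt (gsel C) (@id_subst S) (s ≈ s') C.
  right; split; first exact: selC.
  rewrite id_lsubst id_csubst -lE => l' l'C lt; apply: (lmax _ l'C).
  exact: lgt_ground (gC0 _ l'C) (gC0 _ lC) lt.
have fact w : (s ≈ w) \in C `\ (s ≈ s') -> ggt s w -> nf rules s' <> nf rules w.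
  move=> wC sw; apply: (@counterexample_eqfact (C `\ (s ≈ s') `\ (s ≈ w)) s s' w) => //.
  by rewrite -msetB1D.
have C'C l' : l' \in C `\ (s ≈ s') -> l' \in C.
  exact: (msubset_subset (msubsetDl _ _)).
(* A second copy of the maximal literal is the case [w = s'] of factoring, so maximality is
   strict. *)
have smax l' : l' \in C `\ (s ≈ s') -> lgt ggt (s ≈ s') l'.
  move=> l'C; case: (lle _ (C'C _ l'C)) => [E|//].
  by rewrite E in l'C; case: (fact s' l'C ss').
have sel : sup_eligible gt (gsel C) (@id_subst S) (s ≈ s') C.
  right; split; first exact: selC.
  rewrite id_lsubst id_csubst => l' l'C [E|lt].
    by apply: (lgt_irr gt_simpl (l := l')); rewrite -{1}E; apply: smax.
  have gl' := gC0 _ (C'C _ l'C); have gl := gC0 _ lC; rewrite lE in gl.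
  apply: (lgt_irr gt_simpl (l := l')).
  exact: lgt_trans gt_simpl _ _ _ (lgt_ground gl' gl lt) (smax _ l'C).
have notbelow K t t' : s = plug K t -> rules t = Some t' -> ~ ggt s t.
  move=> sE Rt st; apply: (counterexample_reduce CE sel ss' sE Rt); left.
  exists l => //; rewrite lE; have [tt' _] := rules_decreasing Rt.
  by apply: lgt_lt_sides => //; apply: ggt_trans tt'.
have args f ts u : s = App f ts -> u \in ts -> ggt s u /\ nf rules u = u.
  move=> sE uts; have su : ggt s u by rewrite sE; apply: ggt_arg => //; rewrite -sE.
  split=> //; apply: NNPP => nu; have [_ gu _] := su.
  have [K [t [t' [uE Rt]]]] := nf_reducible rules_decreasing gu nu.
  move/path.splitPr: uts sE => tsE; case: tsE => us vs sE.
  apply: (notbelow (CApp f us K vs) t t' _ Rt); first by rewrite sE uE.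
  by apply: le_ggt_trans su => //; rewrite uE; apply: plug_le => //; rewrite -uE.
have cC : candidate (rules_below s) s C s'.
  split; first by split=> //; [exact: counterexample_nonredundant | rewrite -lE].
  split=> // [f ts u sE uts|]; first by have [su uE] := args _ _ _ sE uts; rewrite nf_below.
  move=> [l' l'C tl']; apply: CF; exists l'; first exact: C'C.
  have [u [v [l'E gu gv tyuv]]] := gC0 _ (C'C _ l'C).
  wlog vu : u v l'E gu gv tyuv / le_of ggt v u.
    move=> W; case: (ggt_total gt_simpl gu gv) => h.
    - by apply: (W u v) => //; left.
    - by apply: (W u v) => //; right.
    - by apply: (W v u) => //; [rewrite l'E lit_sym | right].
  have us : le_of ggt u s.
    by apply: (lgt_mem_le gt_simpl ss' (lle _ (C'C _ l'C))); rewrite l'E mem_lit eqxx.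
  have low w : ggt s w -> nf (add_rule (rules_below s) s s') w = nf rules w.
    by move=> sw; apply: nf_add_rule_below.
  rewrite l'E in tl' *; case: us => [uE|su]; last first.
    have sv := le_ggt_trans gt_simpl vu su.
    move/true_lit_lit: tl'; rewrite !low // => h.
    exact: (proj2 (true_lit_lit gt_simpl rules _ u v)) h.
  (* Another literal with larger side [s]: if positive, the new rule makes it true only by equating
     right-hand sides, which factoring excludes; if negative, it would exceed the maximal
     literal. *)
  rewrite uE in l'E tl' vu *; case l'1: l'.1 l'E tl' => l'E tl'.
    case: vu => [vE|sv]; first by rewrite vE; apply/true_lit_lit.
    have wC : (s ≈ v) \in C `\ (s ≈ s') by rewrite -l'E.
    case: (fact v wC sv); rewrite -(low _ ss') -(low _ sv).
    move/true_lit_lit: tl' => <-; apply/esym.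
    have Rdec : decreasing_rules gt (add_rule (rules_below s) s s').
      exact/add_rule_decreasing/tyE/ss'/rules_below_decreasing.
    apply: (nf_rule Rdec) => //; first by rewrite /add_rule eqxx.
    by move=> f ts w sE wts; have [sw' E] := args _ _ _ sE wts; rewrite low.
  case: (lgt_irr gt_simpl (l := l')); apply: lgt_trans (smax _ l'C) => //.
  by rewrite l'E; apply: lgt_neg_pos.
have [t Rs] := rules_candidate cC.
apply: (counterexample_reduce CE sel ss' (K := Hole S) erefl Rs); right.
by exists s'.
Qed.

End MinimalCounterexample.
Theorem ground_completeness :
  exists2 R, decreasing_rules gt R & forall C, M C -> true_clause R C.
Proof.
exists rules; first exact: rules_decreasing.
move=> C; elim/(well_founded_induction (cgt_wf gt_simpl)): C => C IH MC.
apply: NNPP => CF.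
have IH' D : M D -> cgt ggt C D -> true_clause rules D by move=> MD CD; apply: IH CD MD.
have [selC|/fset0Pn[l lsel]] := eqVneq (gsel C) fset0; last first.
  have [lC l1] := gsel_fun (M_ground MC) lsel.
  by apply: (counterexample_negative MC CF IH' lC l1); left.
have C0 : C != mset0 by apply/negP => /eqP CE; apply: M_bot; rewrite /bot -CE.
have [l lC lmax] := exists_maximal (lgt_trans gt_simpl) (lgt_irr gt_simpl) C0.
case l1: l.1; first exact: (counterexample_positive MC CF IH' lC l1 selC lmax).
apply: (counterexample_negative MC CF IH' lC l1); right; split=> //.
rewrite id_lsubst id_csubst => l' l'C lt; apply: (lmax _ l'C).
by have /ground_clauseP gC := M_ground MC; apply: lgt_ground lt; apply: gC.
Qed.

End GroundCompleteness.

(** * Lifting of ground inferences *)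

Section LiftTerms.
Context (S : signature).
Implicit Types (s t u : term S) (sigma tau theta : subst S) (K : ctx S).
Implicit Types (l : literal S) (C D : clause S).

(* Applications weigh two, so that a constant is heavier than a variable. *)
Fixpoint tweight t : nat :=
  match t with
  | Var _ => 1
  | App _ ts => 2 + sumn (map tweight ts)
  end.

Lemma tweight_gt0 t : 0 < tweight t. Proof. by case: t. Qed.

Lemma tweight_arg f ts u : u \in ts -> tweight u < tweight (App f ts).
Proof.
move=> uts /=; suff : tweight u <= sumn (map tweight ts) by lia.
elim: ts uts => // t ts IH; rewrite inE => /orP[/eqP -> /=|/IH /=]; lia.
Qed.

Lemma tweight_tsubst_var theta t x : x \in tvars t ->
  tweight (theta x) <= tweight (tsubst theta t).
Proof.
elim/term_mem_ind: t => [y|f ts IH /(mem_tvars_App f)[t tts xt]].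
  by rewrite inE => /eqP ->.
apply: leq_trans (IH t tts xt) _; apply: ltnW; apply: tweight_arg; exact: map_f.
Qed.

(** Otherwise the instance of [t] would contain the image of [x] properly and be heavier. *)
Lemma occurs_check theta x t : theta x = tsubst theta t -> x \in tvars t -> t = Var x.
Proof.
case: t => [y _|f ts E /(mem_tvars_App f)[t tts xt]]; first by rewrite inE => /eqP ->.
have := tweight_tsubst_var theta xt; rewrite E leqNgt.
by rewrite (@tweight_arg f (map (tsubst theta) ts)) //; apply: map_f.
Qed.

(** For the bindings used here, the substitution through which a unifier [theta] factors can be
    taken to be [theta] itself, so instances under [theta] and under [sigma] followed by [theta]
    coincide. *)
Definition factors theta sigma : Prop := forall x, theta x = tsubst theta (sigma x).

Lemma factors_id theta : factors theta (@id_subst S).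
Proof. by []. Qed.

Lemma factors_single theta x t : theta x = tsubst theta t -> factors theta (single x t).
Proof. by move=> E y; rewrite /single; case: eqP => [->|]. Qed.

Lemma factors_tsubst theta sigma t : factors theta sigma ->
  tsubst theta (tsubst sigma t) = tsubst theta t.
Proof. by move=> h; rewrite tsubst_comp; apply: eq_in_tsubst => x _. Qed.

Lemma factors_lsubst theta sigma l : factors theta sigma ->
  lsubst theta (lsubst sigma l) = lsubst theta l.
Proof. by move=> h; rewrite lsubst_comp; apply: eq_lsubst => x. Qed.

Lemma factors_csubst theta sigma C : factors theta sigma ->
  csubst theta (csubst sigma C) = csubst theta C.
Proof. by move=> h; rewrite csubst_comp; apply: eq_csubst => x. Qed.

Lemma wt_id_subst : wt_subst (@id_subst S). Proof. by []. Qed.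

Lemma wt_single x t : wt t -> ty_of t = x.1 -> wt_subst (single x t).
Proof. by move=> wt_t ty_t y; rewrite /single; case: eqP => [->|]. Qed.

Lemma mgu_id u : is_mgu (@id_subst S) u u.
Proof. by split=> // tau wtau _; exists tau. Qed.

Lemma mgu_single x t : wt t -> ty_of t = x.1 -> x \notin tvars t ->
  is_mgu (single x t) (Var x) t.
Proof.
move=> wt_t ty_t xt.
have E : tsubst (single x t) t = t.
  rewrite -[RHS]tsubst_id; apply: eq_in_tsubst => y yt; rewrite /single.
  by case: eqP => // yx; rewrite -yx yt in xt.
split.
- exact: wt_single.
- move=> y; rewrite {2 3}/single; case: eqP => [_|yx]; first exact: E.
  by rewrite /= /single; case: eqP.
- by rewrite E /= /single eqxx.
- by move=> tau wtau tauE; exists tau => // y; rewrite /single; case: eqP => [->|].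
Qed.

Lemma is_mgu_sym sigma u u' : is_mgu sigma u u' -> is_mgu sigma u' u.
Proof. by move=> [? ? ? h]; split=> // tau wtau /esym; apply: h. Qed.

(** Only a variable is ever unified with a term: the result is a single binding, or the identity
    when the occurs check forces both sides to be the same variable. *)
Lemma mgu_var_exists theta u u' : wt u -> wt u' -> ty_of u = ty_of u' ->
  tsubst theta u = tsubst theta u' ->
  (exists x, u = Var x) \/ (exists x, u' = Var x) ->
  exists2 sigma, is_mgu sigma u u' & factors theta sigma.
Proof.
have main x t : wt t -> x.1 = ty_of t -> theta x = tsubst theta t ->
    exists2 sigma, is_mgu sigma (Var x) t & factors theta sigma.
  move=> wt_t ty_t E; case: (boolP (x \in tvars t)) => [/(occurs_check E) ->|xt].
    by exists (@id_subst S); [apply: mgu_id | apply: factors_id].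
  by exists (single x t); [apply: mgu_single | apply: factors_single].
move=> wu wu' ty_u E [[x ux]|[x ux]]; subst.
  exact: main.
have [//||//|sigma mg fs] := main x u; first by rewrite ty_u.
by exists sigma => //; apply: is_mgu_sym.
Qed.

Lemma map_eq_cat (A B : Type) (g : A -> B) (r : seq A) p q : map g r = p ++ q ->
  exists r1 r2, [/\ r = r1 ++ r2, map g r1 = p & map g r2 = q].
Proof.
move=> E; exists (take (size p) r), (drop (size p) r); rewrite cat_take_drop.
by split=> //; rewrite ?map_take ?map_drop E ?take_size_cat ?drop_size_cat.
Qed.

(** The position of [t] is either a non-variable position of [s], where an inference can be lifted,
    or lies at or below a variable. *)
Lemma plug_tsubst theta s K t : tsubst theta s = plug K t ->
  (exists K0 f ss, [/\ s = plug K0 (App f ss), tsubst theta (App f ss) = t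
     & forall u, tsubst theta (plug K0 u) = plug K (tsubst theta u)]) \/
  (exists x K', x \in tvars s /\ theta x = plug K' t).
Proof.
elim: K s => [|f us K IH vs] [x|g ss] /= E.
- by right; exists x, (Hole S); rewrite mem_head.
- by left; exists (Hole S), g, ss.
- by right; exists x, (CApp f us K vs); rewrite mem_head.
case: E => gf /map_eq_cat[us0 [[|s1 vs0] [ssE usE //= [s1E vsE]]]].
case: (IH _ s1E) => [[K0 [h [ss' [s1K tE KE]]]]|[x [K' [xs xE]]]].
  left; exists (CApp g us0 K0 vs0), h, ss'; split=> [|//|u] /=; first by rewrite ssE s1K.
  by rewrite map_cat /= KE usE vsE gf.
right; exists x, K'; split=> //; apply/(mem_tvars_App g); exists s1 => //.
by rewrite ssE mem_cat mem_head orbT.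
Qed.

Lemma lift_sides theta l b s t : wf_literal l -> lsubst theta l = lit b s t ->
  exists s0 t0, [/\ l = lit b s0 t0, tsubst theta s0 = s, tsubst theta t0 = t
                  & [/\ wt s0, wt t0 & ty_of s0 = ty_of t0]].
Proof.
move=> [s0 [t0 [lE ws wt_t tyE]]]; rewrite lE lsubst_lit => /lit_inj[bE [][sE tE]].
  by exists s0, t0; rewrite -bE.
by exists t0, s0; rewrite -bE lit_sym.
Qed.

Lemma sel_substP theta (Sel : {fset (literal S)}) l :
  reflect (exists2 l0, l0 \in Sel & l = lsubst theta l0) (l \in sel_subst theta Sel).
Proof. exact: imfsetP. Qed.

Lemma sel_subst_comp theta sigma tau (Sel : {fset (literal S)}) :
  (forall x, tau x = tsubst theta (sigma x)) ->
  sel_subst theta (sel_subst sigma Sel) = sel_subst tau Sel.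
Proof.
move=> E; have lE l : lsubst theta (lsubst sigma l) = lsubst tau l.
  by rewrite lsubst_comp; apply: eq_lsubst => x; rewrite E.
apply/fsetP => l; apply/sel_substP/sel_substP.
  by move=> [_ /sel_substP[l0 l0S ->] ->]; exists l0.
move=> [l0 l0S ->]; exists (lsubst sigma l0); last by rewrite lE.
by apply/sel_substP; exists l0.
Qed.

Lemma sel_subst_eq0 theta (Sel : {fset (literal S)}) :
  sel_subst theta Sel = fset0 -> Sel = fset0.
Proof.
move=> E; apply/eqP/negPn/negP => /fset0Pn[l lS].
have : lsubst theta l \in sel_subst theta Sel by apply/sel_substP; exists l.
by rewrite E in_fset0.
Qed.

End LiftTerms.

(** * Lifting of ordering conditions and eligibility *)

Section LiftEligibility.
Context (S : signature) (gt : term S -> term S -> Prop).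
Hypothesis gt_simpl : simplification_order gt.
Implicit Types (s t u : term S) (sigma tau theta : subst S) (K : ctx S).
Implicit Types (l : literal S) (C D : clause S).
Local Notation ggt := (ggt gt).

(** By stability, a comparison in the wrong direction under [sigma] would persist under [theta] and
    contradict the ground one. *)
Lemma lift_not_tle theta sigma s t : ground_subst theta -> wt_subst sigma ->
  factors theta sigma -> wt s -> wt t -> gt (tsubst theta s) (tsubst theta t) ->
  ~ tle gt (tsubst sigma s) (tsubst sigma t).
Proof.
move=> gth wsig fs ws wt_t h.
have gs : ggt (tsubst theta s) (tsubst theta t) by split=> //; apply: ground_tsubst.
case=> [E|lt].
  move: gs; rewrite -(factors_tsubst s fs) E (factors_tsubst t fs); exact: ggt_irr.
apply: (ggt_asym gt_simpl gs); split; [exact: ground_tsubst | exact: ground_tsubst |].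
rewrite -(factors_tsubst s fs) -(factors_tsubst t fs).
by apply: (so_subst gt_simpl) lt; [exact: ground_subst_wt | exact: wt_tsubst | exact: wt_tsubst].
Qed.

Lemma lift_not_cle theta sigma C D : ground_subst theta -> wt_subst sigma ->
  factors theta sigma -> wf_clause C -> wf_clause D ->
  cgt gt (csubst theta C) (csubst theta D) -> ~ cle gt (csubst sigma C) (csubst sigma D).
Proof.
move=> gth wsig fs wC wD h.
have gC := csubst_ground gth wC; have gD := csubst_ground gth wD.
have CD := cgt_ground gC gD h.
case=> [E|lt].
  move: CD; rewrite -(factors_csubst C fs) E (factors_csubst D fs); exact: cgt_irr.
apply: (@cgt_irr _ _ gt_simpl (csubst theta C)); apply: cgt_trans CD _ => //.
apply: cgt_ground => //; rewrite -(factors_csubst C fs) -(factors_csubst D fs).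
by apply: cgt_csubst lt => //; [exact: ground_subst_wt | exact: csubst_wf | exact: csubst_wf].
Qed.

Section Premise.
Context (theta : subst S) (C : clause S) (Sel : {fset (literal S)}).
Hypothesis gth : ground_subst theta.
Hypothesis wfC : wf_clause C.
Hypothesis SelC : forall l, l \in Sel -> l \in C.

(** Several literals of [C] may have the instance [l]; when [l] is selected, a selected one has to
    be taken. *)
Lemma lift_literal B C' l : csubst theta C = B -> B = C' `+` [mset l] ->
  l \in sel_subst theta Sel \/ sel_subst theta Sel = fset0 ->
  exists l0 C0, [/\ C = C0 `+` [mset l0], lsubst theta l0 = l, csubst theta C0 = C'
    & (l \in sel_subst theta Sel -> l0 \in Sel)].
Proof.
move=> CB BE hsel.
have [l0 [l0C l0E l0S]] : exists l0, [/\ l0 \in C, lsubst theta l0 = l &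
    (l \in sel_subst theta Sel -> l0 \in Sel)].
  case: hsel => [/sel_substP[l0 l0S ->]|sel0]; first by exists l0; split=> //; apply: SelC.
  have : l \in csubst theta C by rewrite CB BE in_msetD1r eqxx orbT.
  by case/mmapP => l0 l0C ->; exists l0; split=> //; rewrite sel0 in_fset0.
have E : csubst theta C = C' `+` [mset l] by rewrite CB.
by have [CE C0E] := mmap_eqD1 E l0C l0E; exists l0, (C `\ l0).
Qed.

Lemma lift_lgt sigma l l' : wt_subst sigma -> factors theta sigma ->
  wf_literal l -> wf_literal l' ->
  lgt gt (lsubst sigma l) (lsubst sigma l') -> lgt gt (lsubst theta l) (lsubst theta l').
Proof.
move=> wsig fs wl wl' lt; rewrite -(factors_lsubst l fs) -(factors_lsubst l' fs).
by apply: lgt_lsubst lt => //; [exact: ground_subst_wt | exact: lsubst_wf | exact: lsubst_wf].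
Qed.

(** Eligibility is given for all [sigma] at once, because the rule and its substitution are chosen
    only after the shape of the lifted literal is known. *)
Lemma lift_eligible B C' l : csubst theta C = B -> B = C' `+` [mset l] ->
  eligible gt (sel_subst theta Sel) (@id_subst S) l B ->
  exists l0 C0, [/\ C = C0 `+` [mset l0], lsubst theta l0 = l, csubst theta C0 = C'
    & forall sigma, wt_subst sigma -> factors theta sigma -> eligible gt Sel sigma l0 C].
Proof.
move=> CB BE el; have hsel : l \in sel_subst theta Sel \/ sel_subst theta Sel = fset0.
  by case: el => [?|[? _]]; [left|right].
have [l0 [C0 [CE l0E C0E l0S]]] := lift_literal CB BE hsel.
exists l0, C0; split; [exact: CE | exact: l0E | exact: C0E | move=> sigma wsig fs].
case: el => [/l0S lS|[/sel_subst_eq0 S0]]; first by left; exact: lS.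
rewrite id_lsubst id_csubst => lmax; right; split; first exact: S0.
move=> _ /mmapP[l' l'C ->] lt.
have l0C : l0 \in C by rewrite CE in_msetD1r eqxx orbT.
apply: (lmax (lsubst theta l')); first by rewrite -CB; apply: mem_mmap.
by rewrite -l0E; apply: lift_lgt lt => //; apply: wfC.
Qed.

Lemma lift_strictly_eligible B C' l : csubst theta C = B -> B = C' `+` [mset l] ->
  strictly_eligible gt (sel_subst theta Sel) (@id_subst S) l B ->
  exists l0 C0, [/\ C = C0 `+` [mset l0], lsubst theta l0 = l, csubst theta C0 = C'
    & forall sigma, wt_subst sigma -> factors theta sigma -> strictly_eligible gt Sel sigma l0 C].
Proof.
move=> CB BE el; have hsel : l \in sel_subst theta Sel \/ sel_subst theta Sel = fset0.
  by case: el => [?|[? _]]; [left|right].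
have [l0 [C0 [CE l0E C0E l0S]]] := lift_literal CB BE hsel.
exists l0, C0; split; [exact: CE | exact: l0E | exact: C0E | move=> sigma wsig fs].
case: el => [/l0S lS|[/sel_subst_eq0 S0]]; first by left; exact: lS.
rewrite id_lsubst id_csubst BE /strictly_maximal msetD1B => lmax.
right; split; first exact: S0.
rewrite CE /strictly_maximal csubstD csubst1 msetD1B => _ /mmapP[l' l'C ->] lt.
have l0C : l0 \in C by rewrite CE in_msetD1r eqxx orbT.
have l'C0 : l' \in C by rewrite CE in_msetD1r l'C.
apply: (lmax (lsubst theta l')); first by rewrite -C0E; apply: mem_mmap.
case: lt => [E|lt]; [left | right].
  by rewrite -l0E -(factors_lsubst l0 fs) E factors_lsubst.
by rewrite -l0E; apply: lift_lgt lt => //; apply: wfC.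
Qed.

Lemma lift_sup_eligible B C' l : csubst theta C = B -> B = C' `+` [mset l] ->
  sup_eligible gt (sel_subst theta Sel) (@id_subst S) l B ->
  exists l0 C0, [/\ C = C0 `+` [mset l0], lsubst theta l0 = l, csubst theta C0 = C'
    & forall sigma, wt_subst sigma -> factors theta sigma -> sup_eligible gt Sel sigma l0 C].
Proof.
move=> CB BE; rewrite /sup_eligible; case l1: l.1 => el.
  have [l0 [C0 [CE l0E C0E el0]]] := lift_strictly_eligible CB BE el.
  by exists l0, C0; have -> : l0.1 = true by rewrite -l1 -l0E.
have [l0 [C0 [CE l0E C0E el0]]] := lift_eligible CB BE el.
by exists l0, C0; have -> : l0.1 = false by rewrite -l1 -l0E.
Qed.

End Premise.

Lemma lgt_smaller_instance theta theta' l : ground_subst theta -> ground_subst theta' ->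
  (forall x, le_of ggt (theta' x) (theta x)) -> wf_literal l ->
  lsubst theta l = lsubst theta' l \/ lgt ggt (lsubst theta l) (lsubst theta' l).
Proof.
move=> gth gth' h wl.
have le u : u \in l.2 -> tsubst theta u = tsubst theta' u \/ ggt (tsubst theta u) (tsubst theta' u).
  move=> ul; have := le_tsubst gt_simpl gth gth' h (wf_literal_mem wl ul).
  by case=> [->|]; [left|right].
have [[u ul lt]|nlt] := classic (exists2 u, u \in l.2 & ggt (tsubst theta u) (tsubst theta' u)).
  right; rewrite /lgt !lit_mset_lsubst; apply: mulgt_mmap_lt => [v|].
    by rewrite mem_lit_mset; apply: le.
  by exists u => //; rewrite mem_lit_mset.
left; apply: eq_in_lsubst => u ul; case: (le _ ul) => // lt; case: nlt; by exists u.
Qed.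

(** Every literal decreases weakly, and one that contains [x] strictly, since equal instances of a
    term agree on its variables. *)
Lemma cgt_smaller_instance theta theta' C x : ground_subst theta -> ground_subst theta' ->
  (forall x, le_of ggt (theta' x) (theta x)) -> wf_clause C ->
  x \in cvars C -> theta x <> theta' x ->
  cgt ggt (csubst theta C) (csubst theta' C).
Proof.
move=> gth gth' h wC /mem_cvars[l [t [lC tl xt]]] nx.
apply: mulgt_mmap_lt => [l' /wC|]; first exact: lgt_smaller_instance.
exists l => //; case: (lgt_smaller_instance gth gth' h (wC _ lC)) => // E.
exfalso; case: (le_tsubst gt_simpl gth gth' h (wf_literal_mem (wC _ lC) tl)) => [tE|lt].
  by case: nx; apply/esym/(tsubst_inj_in tE).
have : lgt ggt (lsubst theta l) (lsubst theta' l).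
  rewrite /lgt !lit_mset_lsubst; apply: mulgt_mmap_lt => [v|].
    rewrite mem_lit_mset => vl.
    have := le_tsubst gt_simpl gth gth' h (wf_literal_mem (wC _ lC) vl).
    by case=> [->|]; [left|right].
  by exists t => //; rewrite mem_lit_mset.
by rewrite E; apply: lgt_irr.
Qed.

End LiftEligibility.

Section Rules.
Context (S : signature) (gt : term S -> term S -> Prop) (sel : selection S).
Implicit Types (s t u v : term S) (C D : clause S).

Lemma rule_Sup D0 C0 rho1 rho2 D C D' C' f ts ss t' K b s' :
  csubst (ren rho1) D0 = D -> csubst (ren rho2) C0 = C ->
  D = D' `+` [mset App f ts ≈ t'] -> C = C' `+` [mset lit b (plug K (App f ss)) s'] ->
  sup_side gt sel (@id_subst S) D0 C0 rho1 rho2 (App f ts) t' b (plug K (App f ss)) s' ->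
  rule gt sel (Inference [:: D0; C0] [:: D; C]
    (C' `+` D' `+` [mset lit b (plug K t') s']) (CS ts ss)).
Proof. move=> hD hC DE CE; rewrite DE in hD *; rewrite CE in hC *; exact: Sup. Qed.

Lemma rule_VSup D0 C0 rho1 rho2 D C D' C' x f ss t' K b s' :
  csubst (ren rho1) D0 = D -> csubst (ren rho2) C0 = C ->
  D = D' `+` [mset Var x ≈ t'] -> C = C' `+` [mset lit b (plug K (App f ss)) s'] ->
  x.1 = res_ty f ->
  sup_side gt sel (single x (App f ss)) D0 C0 rho1 rho2 (Var x) t' b (plug K (App f ss)) s' ->
  rule gt sel (Inference [:: D0; C0] [:: D; C]
    (csubst (single x (App f ss)) (C' `+` D' `+` [mset lit b (plug K t') s'])) mset0).
Proof. move=> hD hC DE CE ty_x; rewrite DE in hD *; rewrite CE in hC *; exact: VSup. Qed.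

Lemma rule_EqFact C C' f ts ss v v' :
  C = C' `+` [mset App f ts ≈ v'] `+` [mset App f ss ≈ v] ->
  eligible gt (sel C) (@id_subst S) (App f ss ≈ v) C ->
  ~ tle gt (App f ss) v -> ~ tle gt (App f ts) v' ->
  rule gt sel (Inference [:: C] [:: C]
    (C' `+` [mset v ≉ v'] `+` [mset App f ss ≈ v]) (CS ts ss)).
Proof. by move=> ->; apply: EqFact. Qed.

Lemma rule_VEqFact C C' u u' v v' sigma :
  C = C' `+` [mset u' ≈ v'] `+` [mset u ≈ v] ->
  (exists x, u = Var x) \/ (exists x, u' = Var x) ->
  is_mgu sigma u u' -> eligible gt (sel C) sigma (u ≈ v) C ->
  ~ tle gt (tsubst sigma u) (tsubst sigma v) ->
  ~ tle gt (tsubst sigma u') (tsubst sigma v') ->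
  rule gt sel (Inference [:: C] [:: C]
    (csubst sigma (C' `+` [mset v ≉ v'] `+` [mset u ≈ v])) mset0).
Proof. by move=> ->; apply: VEqFact. Qed.

Lemma rule_Decompose C C' f ss ts : C = C' `+` [mset App f ss ≉ App f ts] ->
  App f ss <> App f ts -> eligible gt (sel C) (@id_subst S) (App f ss ≉ App f ts) C ->
  rule gt sel (Inference [:: C] [:: C] C' (CS ts ss)).
Proof. by move=> ->; apply: Decompose. Qed.

Lemma rule_Bind C C' x t : C = C' `+` [mset Var x ≉ t] -> x \notin tvars t ->
  eligible gt (sel C) (single x t) (Var x ≉ t) C ->
  rule gt sel (Inference [:: C] [:: C] (csubst (single x t) C') mset0).
Proof. by move=> ->; apply: Bind. Qed.

Lemma rule_ReflDel C C' s : C = C' `+` [mset s ≉ s] ->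
  eligible gt (sel C) (@id_subst S) (s ≉ s) C ->
  rule gt sel (Inference [:: C] [:: C] C' mset0).
Proof. by move=> ->; apply: ReflDel. Qed.

End Rules.

(** * Renaming premises apart *)

Section RenamingApart.
Context (S : signature).
Implicit Types (theta : subst S) (C D : clause S).

(** Even and odd indices separate any two clauses uniformly, and [join_subst] decodes both by
    parity. *)
Definition even_var (x : var S) : var S := (x.1, x.2.*2).
Definition odd_var (x : var S) : var S := (x.1, x.2.*2.+1).

Definition join_subst theta1 theta2 : subst S :=
  fun x => (if odd x.2 then theta2 else theta1) (x.1, x.2./2).

Lemma renaming_even : renaming even_var.
Proof. by split=> // [[a n] [b m]] [-> nm]; congr pair; lia. Qed.

Lemma renaming_odd : renaming odd_var.
Proof. by split=> // [[a n] [b m]] [-> nm]; congr pair; lia. Qed.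

Lemma wt_ren rho : @renaming S rho -> wt_subst (ren rho).
Proof. by move=> [_ h] x; split=> //=. Qed.

Lemma join_even theta1 theta2 (x : var S) :
  theta1 x = tsubst (join_subst theta1 theta2) (ren even_var x).
Proof. by case: x => a n; rewrite /= /join_subst /= odd_double doubleK. Qed.

Lemma join_odd theta1 theta2 (x : var S) :
  theta2 x = tsubst (join_subst theta1 theta2) (ren odd_var x).
Proof. by case: x => a n; rewrite /= /join_subst /= odd_double /= uphalf_double. Qed.

Lemma join_ground theta1 theta2 : ground_subst theta1 -> ground_subst theta2 ->
  ground_subst (join_subst theta1 theta2).
Proof. by move=> h1 h2 x; rewrite /join_subst; case: odd; [apply: h2 | apply: h1]. Qed.

Lemma mem_cvars_ren rho C x : x \in cvars (csubst (ren rho) C) -> exists y : var S, x = rho y.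
Proof.
move=> /mem_cvars[_ [_ [/mmapP[l lC ->] /mmapP[t tl ->] /mem_tvars_tsubst[y _]]]].
by rewrite inE => /eqP ->; exists y.
Qed.

Lemma disjoint_even_odd C D :
  disjoint_vars (csubst (ren even_var) C) (csubst (ren odd_var) D).
Proof.
move=> x /mem_cvars_ren[y xy]; apply/negP => /mem_cvars_ren[z xz].
by move: (congr1 (fun v : var S => odd v.2) xz); rewrite xy /= !odd_double.
Qed.

Lemma csubst_ren theta tau rho C : (forall x, tau x = tsubst theta (ren rho x)) ->
  csubst theta (csubst (ren rho) C) = csubst tau C.
Proof. by move=> h; rewrite csubst_comp; apply: eq_csubst => x; rewrite h. Qed.

End RenamingApart.

(** * Lifting of the inference rules *)

Section Lifting.
Context (S : signature) (gt : term S -> term S -> Prop).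
Hypothesis gt_simpl : simplification_order gt.
Context (sel : selection S) (sel_fun : selection_function sel).
Context (N : clause_set S) (N_wf : wf_clause_set N).
Implicit Types (s t u v : term S) (l : literal S) (C D : clause S).
Local Notation ggt := (ggt gt).

(* The ground clause [C] inherits its selection from its representation
   [rep C] as an instance. *)
Context (rep : clause S -> clause S * subst S).
Let gsel : selection S := fun C => sel_subst (rep C).2 (sel (rep C).1).
Hypothesis rep_inst : forall C, GN N C ->
  [/\ N (rep C).1, ground_subst (rep C).2 & csubst (rep C).2 (rep C).1 = C].

Definition lifts (ig : ginference S) : Prop :=
  exists i, [/\ Inf gt sel i, forall C, C \in prems i -> N C & GI gt gsel i ig].

Lemma lifts_unary C D theta E core constr : GN N C -> rep C = (D, theta) ->
  rule gt sel (Inference [:: D] [:: D] core constr) ->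
  GInf gt gsel (GInference [:: C] E) -> csubst theta core = E ->
  lifts (GInference [:: C] E).
Proof.
move=> NC repC hr hg coreE; have [ND gth DC] := rep_inst NC.
rewrite repC /= in ND gth DC.
exists (Inference [:: D] [:: D] core constr); split.
- by split=> // B; rewrite inE => /eqP ->; apply: N_wf.
- by move=> B; rewrite inE => /eqP ->.
- by split=> //; exists theta; split=> /=; [exact: ground_subst_wt | rewrite DC | rewrite coreE].
Qed.

Lemma sel_mem C l : wf_clause C -> l \in sel C -> l \in C.
Proof. by move=> wC /(sel_fun wC)[]. Qed.

(** The sides of the lifted literal are equal, or one is a variable, or both are applications of the
    same symbol: [ReflDel], [Bind] or [Decompose]. Only the core is instantiated, so the constraints
    of [Decompose] do not appear in the ground conclusion. *)
Lemma lift_eqres C C' s : C = C' `+` [mset s ≉ s] -> GN N C -> ground_clause C ->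
  eligible gt (gsel C) (@id_subst S) (s ≉ s) C ->
  lifts (GInference [:: C] C').
Proof.
move=> CE NC gC el; have hg := GInf_eqres CE gC el.
have [ND gth DC] := rep_inst NC; move: el; rewrite /gsel.
case repC: (rep C) ND gth DC => [D theta] /= ND gth DC el.
have wD := N_wf ND.
have [l0 [D0 [DE l0E D0E el0]]] := lift_eligible gt_simpl gth wD (fun l => sel_mem wD) DC CE el.
have l0D : l0 \in D by rewrite DE in_msetD1r eqxx orbT.
have [s1 [s2 [l0L s1E s2E [ws1 ws2 tyE]]]] := lift_sides (wD _ l0D) l0E.
have bind x t : wt t -> ty_of t = x.1 -> theta x = tsubst theta t -> t <> Var x ->
    l0 = (Var x ≉ t) -> lifts (GInference [:: C] C').
  move=> wt_t ty_x xE tx l0x; rewrite l0x in DE el0.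
  have xt : x \notin tvars t by apply/negP => /(occurs_check xE).
  have fs := factors_single xE.
  have hr := rule_Bind DE xt (el0 _ (wt_single wt_t ty_x) fs).
  by apply: (lifts_unary NC repC hr hg); rewrite factors_csubst.
have [s12|s12] := eqVneq s1 s2.
  rewrite l0L s12 in DE el0.
  exact: lifts_unary NC repC (rule_ReflDel DE (el0 _ (@wt_id_subst _) (factors_id _))) hg D0E.
have E12 : tsubst theta s1 = tsubst theta s2 by rewrite s1E s2E.
case: s1 => [x|f ss] in l0L s1E ws1 tyE s12 E12 *.
  by apply: (bind x s2 ws2 (esym tyE) E12 _ l0L); apply/eqP; rewrite eq_sym.
case: s2 => [x|g ts] in l0L s2E ws2 tyE s12 E12 *.
  by apply: (bind x (App f ss) ws1 tyE (esym E12)); [exact/eqP | rewrite l0L lit_sym].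
case: E12 => fg _; rewrite -fg in s12 l0L; rewrite l0L in DE el0.
have hr := rule_Decompose DE (elimN eqP s12) (el0 _ (@wt_id_subst _) (factors_id _)).
exact: lifts_unary NC repC hr hg D0E.
Qed.

Lemma lift_eqfact C C' u v v' : C = C' `+` [mset u ≈ v'] `+` [mset u ≈ v] ->
  GN N C -> ground_clause C ->
  eligible gt (gsel C) (@id_subst S) (u ≈ v) C -> gt u v -> gt u v' ->
  lifts (GInference [:: C] (C' `+` [mset v ≉ v'] `+` [mset u ≈ v])).
Proof.
move=> CE NC gC el uv uv'; have hg := GInf_eqfact CE gC el uv uv'.
have [ND gth DC] := rep_inst NC; move: el; rewrite /gsel.
case repC: (rep C) ND gth DC => [D theta] /= ND gth DC el.
have wD := N_wf ND.
have [l0 [D1 [DE l0E D1E el0]]] := lift_eligible gt_simpl gth wD (fun l => sel_mem wD) DC CE el.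
have l0D : l0 \in D by rewrite DE in_msetD1r eqxx orbT.
have [l1 l1D1 /esym l1E] : exists2 l1, l1 \in D1 & (u ≈ v') = lsubst theta l1.
  by apply: mmapP; rewrite -/(csubst theta D1) D1E in_msetD1r eqxx orbT.
have l1D : l1 \in D by rewrite DE in_msetD1r l1D1.
have [D1D D0E] := mmap_eqD1 D1E l1D1 l1E.
have [u0 [v0 [l0L u0E v0E [wu0 wv0 ty0]]]] := lift_sides (wD _ l0D) l0E.
have [u1 [v1 [l1L u1E v1E [wu1 wv1 ty1]]]] := lift_sides (wD _ l1D) l1E.
move: D1D D0E; set D0 := D1 `\ l1 => D1D D0E; clearbody D0.
have {}D0E : csubst theta D0 = C' by exact: D0E.
rewrite l0L D1D l1L in DE; rewrite l0L in el0.
have coreE : csubst theta (D0 `+` [mset v0 ≉ v1] `+` [mset u0 ≈ v0]) =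
    C' `+` [mset v ≉ v'] `+` [mset u ≈ v].
  rewrite csubstD csubst1 csubstD csubst1 !lsubst_lit D0E u0E v0E v1E; reflexivity.
have uu : tsubst theta u0 = tsubst theta u1 by rewrite u0E u1E.
have nle sigma : wt_subst sigma -> factors theta sigma ->
    ~ tle gt (tsubst sigma u0) (tsubst sigma v0) /\ ~ tle gt (tsubst sigma u1) (tsubst sigma v1).
  move=> wsig fs; split; apply: (lift_not_tle gt_simpl gth wsig fs) => //.
    by rewrite u0E v0E.
  by rewrite u1E v1E.
have [isv|isv] := classic ((exists x, u0 = Var x) \/ (exists x, u1 = Var x)).
  have ty_u : ty_of u0 = ty_of u1.
    have wth := ground_subst_wt gth.
    by rewrite -(ty_tsubst u0 wth) uu ty_tsubst.
  have [sigma mg fs] := mgu_var_exists wu0 wu1 ty_u uu isv.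
  have [wsig _ _ _] := mg; have [n0 n1] := nle _ wsig fs.
  have hr := rule_VEqFact DE isv mg (el0 _ wsig fs) n0 n1.
  by apply: (lifts_unary NC repC hr hg); rewrite factors_csubst.
have [n0 n1] := nle _ (@wt_id_subst _) (factors_id _).
rewrite !tsubst_id in n0 n1.
case u0V: u0 => [x|f ss]; first by case: isv; left; exists x.
case u1V: u1 => [x|g ts]; first by case: isv; right; exists x.
rewrite u0V u1V in uu; case: uu => fg _.
rewrite u0V in DE el0 coreE n0; rewrite u1V -fg in DE n1.
have hr := rule_EqFact DE (el0 _ (@wt_id_subst _) (factors_id _)) n0 n1.
exact: lifts_unary NC repC hr hg coreE.
Qed.

(* Rewriting the value of the variable yields a smaller instance of the same
   premise. *)
Lemma sup_variable_redundant theta C1 l0 D D' C C' K K' x t t' b s s' :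
  ground_subst theta -> wf_clause C1 ->
  (forall theta', ground_subst theta' -> GN N (csubst theta' C1)) ->
  csubst theta C1 = C -> C1 = C' `+` [mset l0] ->
  lsubst theta l0 = lit b s s' -> s = plug K t ->
  x \in cvars C1 -> theta x = plug K' t ->
  GN N D -> D = D' `+` [mset t ≈ t'] -> ggt t t' -> ty_of t = ty_of t' -> cgt gt C D ->
  entailed_below gt (GN N) C (csubst theta C' `+` D' `+` [mset lit b (plug K t') s']).
Proof.
move=> gth wC1 instN C1E C1D l0E sE xC1 xE ND DE tt' ty_t CD.
pose theta' y := if y == x then plug K' t' else theta y.
have [_ gt' _] := tt'.
have gx : ground_term (plug K' t) by rewrite -xE; case: (gth x).
have [gx' tyx'] := ground_plug gx gt' ty_t.
have gth' : ground_subst theta'.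
  move=> y; rewrite /theta'; case: eqP => [->|_]; last exact: gth.
  by split=> //; rewrite -tyx' -xE; case: (gth x).
have ltx := ggt_plug gt_simpl tt' gx ty_t.
have lex y : le_of ggt (theta' y) (theta y).
  by rewrite /theta'; case: eqP => [->|_]; [right; rewrite xE | left].
have nx : theta x <> theta' x.
  by rewrite /theta' eqxx xE => E; move: ltx; rewrite E; apply: ggt_irr.
have CC := cgt_smaller_instance gt_simpl gth gth' lex wC1 xC1 nx.
exists [:: D; csubst theta' C1].
  move=> B; rewrite !inE => /orP[]/eqP -> //; split; first exact: instN.
  by rewrite -C1E; apply: cgt_ggt.
move=> I hI v hv.
have [|l lD hl] := hI D _ v hv; first by rewrite inE eqxx.
rewrite DE in_msetD1r in lD; case/orP: lD => [lD'|/eqP lE].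
  by exists l => //; rewrite in_msetD1r in_msetD lD' orbT.
rewrite lE in hl; have tE : eval v t = eval v t' by move/holds_lit_lit: hl.
have plugE K0 : eval v (plug K0 t) = eval v (plug K0 t').
  by elim: K0 => //= f us K0 IH vs; rewrite !map_cat /= IH.
(* Where [t] and [t'] have the same value, both instances of [C1] have the same truth value. *)
have evE u : eval v (tsubst theta' u) = eval v (tsubst theta u).
  elim/term_mem_ind: u => [y|f ts IH] /=.
    by rewrite /theta'; case: eqP => [->|//]; rewrite xE plugE.
  by congr fn; rewrite -!map_comp; apply/eq_in_map.
have holdsE l1 : l1 \in C1 -> holds_lit v (lsubst theta' l1) -> holds_lit v (lsubst theta l1).
  by move=> /wC1[u [w [-> _ _ _]]]; rewrite !lsubst_lit !holds_lit_lit !evE.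
have [|_ /mmapP[l1 l1C1 ->] hl1] := hI (csubst theta' C1) _ v hv.
  by rewrite !inE eqxx orbT.
have {}hl1 := holdsE _ l1C1 hl1.
move: (l1C1); rewrite C1D in_msetD1r => /orP[l1C'|/eqP l1E].
  by exists (lsubst theta l1) => //; rewrite in_msetD1r in_msetD mem_mmap.
exists (lit b (plug K t') s'); first by rewrite in_msetD1r eqxx orbT.
rewrite l1E l0E sE in hl1; move: hl1; rewrite !holds_lit_lit plugE; exact.
Qed.

Lemma lift_sup D C D' C' t t' K b s' :
  D = D' `+` [mset t ≈ t'] -> C = C' `+` [mset lit b (plug K t) s'] ->
  GN N D -> GN N C -> ground_clause D -> ground_clause C ->
  strictly_eligible gt (gsel D) (@id_subst S) (t ≈ t') D ->
  sup_eligible gt (gsel C) (@id_subst S) (lit b (plug K t) s') C ->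
  gt t t' -> gt (plug K t) s' -> cgt gt C D ->
  let E := C' `+` D' `+` [mset lit b (plug K t') s'] in
  lifts (GInference [:: D; C] E) \/ entailed_below gt (GN N) C E.
Proof.
move=> DE CE ND NC gD gC elD elC tt' ss' CD.
have hg := GInf_sup DE CE gD gC elD elC tt' ss' CD.
have gtt' : ggt t t' /\ ty_of t = ty_of t'.
  have /ground_clauseP/(_ (t ≈ t')) := gD; rewrite DE in_msetD1r eqxx orbT.
  by move=> /(_ isT)/ground_lit_lit[].
case: gtt' => gtt' ty_t /=.
have [ND0 gth1 D0D] := rep_inst ND; move: elD; rewrite /gsel.
case: (rep D) ND0 gth1 D0D => [D0 theta1] /= ND0 gth1 D0D elD.
have [NC0 gth2 C0C] := rep_inst NC; move: elC; rewrite /gsel.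
case: (rep C) NC0 gth2 C0C => [C0 theta2] /= NC0 gth2 C0C elC.
pose theta := join_subst theta1 theta2.
have gth : ground_subst theta by apply: join_ground.
have wth := ground_subst_wt gth.
have r1 := renaming_even S; have r2 := renaming_odd S.
pose D1 := csubst (ren (@even_var S)) D0; pose C1 := csubst (ren (@odd_var S)) C0.
pose SelD := sel_subst (ren (@even_var S)) (sel D0).
pose SelC := sel_subst (ren (@odd_var S)) (sel C0).
have wD1 : wf_clause D1 by apply: csubst_wf (N_wf ND0); apply: wt_ren.
have wC1 : wf_clause C1 by apply: csubst_wf (N_wf NC0); apply: wt_ren.
have D1D : csubst theta D1 = D by rewrite -D0D; apply/csubst_ren/join_even.
have C1C : csubst theta C1 = C by rewrite -C0C; apply/csubst_ren/join_odd.
have SelDD l : l \in SelD -> l \in D1.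
  by case/sel_substP => l1 l1D ->; apply/mem_mmap/sel_mem => //; apply: N_wf.
have SelCC l : l \in SelC -> l \in C1.
  by case/sel_substP => l1 l1C ->; apply/mem_mmap/sel_mem => //; apply: N_wf.
(* The inherited selection is re-expressed as the [theta]-image of the selection on the renamed
   premise. *)
rewrite -(sel_subst_comp _ (@join_even S theta1 theta2)) in elD.
rewrite -(sel_subst_comp _ (@join_odd S theta1 theta2)) in elC.
have [lD [D1' [D1E lDE D1'E elD1]]] := lift_strictly_eligible gt_simpl gth wD1 SelDD D1D DE elD.
have [lC [C1' [C1E lCE C1'E elC1]]] := lift_sup_eligible gt_simpl gth wC1 SelCC C1C CE elC.
have lDD1 : lD \in D1 by rewrite D1E in_msetD1r eqxx orbT.
have lCC1 : lC \in C1 by rewrite C1E in_msetD1r eqxx orbT.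
have [t0 [t0' [lDL t0E t0'E [wt0 wt0' _]]]] := lift_sides (wD1 _ lDD1) lDE.
have [s0 [s0' [lCL s0E s0'E [ws0 ws0' _]]]] := lift_sides (wC1 _ lCC1) lCE.
case: (plug_tsubst s0E) => [[K0 [f [ss [s0K fE KE]]]]|[x [K' [xs xE]]]]; last first.
  right; rewrite -C1'E.
  apply: (@sup_variable_redundant theta C1 lC D D' C C1' K K' x t t' b (plug K t) s') => //.
  - move=> theta' gth'; exists C0 => //.
    rewrite /C1 csubst_comp; apply: ground_subst_G; last exact: N_wf.
    by move=> y; apply: gth'.
  - by apply/mem_cvars; exists lC, s0; rewrite {2}lCL mem_lit eqxx.
left.
(* [sigma] stays open: it is a binding for [VSup] and the identity for [Sup], depending on the shape
   of [t0]. *)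
have side sigma : wt_subst sigma -> factors theta sigma ->
    sup_side gt sel sigma D0 C0 (@even_var S) (@odd_var S) t0 t0' b (plug K0 (App f ss)) s0'.
  move=> wsig fs; split; first by split=> //; apply: disjoint_even_odd.
  rewrite -s0K; split.
  - by rewrite -lDL; apply: elD1.
  - by rewrite -lCL; apply: elC1.
  - by apply: (lift_not_tle gt_simpl gth) => //; rewrite t0E t0'E.
  - by apply: (lift_not_tle gt_simpl gth) => //; rewrite s0E s0'E.
  - by apply: (lift_not_cle gt_simpl gth) => //; rewrite -/C1 -/D1 C1C D1D.
rewrite lDL in D1E; rewrite lCL s0K in C1E.
have coreE : csubst theta (C1' `+` D1' `+` [mset lit b (plug K0 t0') s0']) =
    C' `+` D' `+` [mset lit b (plug K t') s'].
  rewrite csubstD csubstD csubst1 lsubst_lit C1'E D1'E KE t0'E s0'E; reflexivity.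
have finish core constr : rule gt sel (Inference [:: D0; C0] [:: D1; C1] core constr) ->
    csubst theta core = C' `+` D' `+` [mset lit b (plug K t') s'] ->
    lifts (GInference [:: D; C] (C' `+` D' `+` [mset lit b (plug K t') s'])).
  move=> hr cE; exists (Inference [:: D0; C0] [:: D1; C1] core constr); split.
  - by split=> // B; rewrite !inE => /orP[]/eqP ->; apply: N_wf.
  - by move=> B; rewrite !inE => /orP[]/eqP ->.
  - by split=> //; exists theta; split=> //=; rewrite D1D C1C.
case t0V: t0 => [x|g ts]; rewrite t0V in D1E t0E side.
  have fsx : theta x = tsubst theta (App f ss) by rewrite fE.
  have fs := factors_single fsx.
  have wf_ss : wt (App f ss).
    move: ws0; rewrite s0K; elim: (K0) => //= h us K1 IH vs /andP[/allP h1 _].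
    by apply: IH; apply: h1; rewrite mem_cat mem_head orbT.
  have ty_x : res_ty f = x.1 by have [_ <-] := wth x; rewrite fsx.
  have hr := rule_VSup erefl erefl D1E C1E (esym ty_x) (side _ (wt_single wf_ss ty_x) fs).
  by apply: finish hr _; rewrite factors_csubst.
have gf : g = f by move: t0E; rewrite -fE => -[].
rewrite gf in D1E side.
exact: finish (rule_Sup erefl erefl D1E C1E (side _ (@wt_id_subst _) (factors_id _))) coreE.
Qed.

Lemma lifting ig : GInf gt gsel ig -> (forall C, C \in gprems ig -> GN N C) ->
  lifts ig \/ entailed_below gt (GN N) (max_prem ig) (gconcl ig).
Proof.
case=> [D' t t' C' K b s' lD lC D C gD gC elD elC tt' ss' CD|C' u v v' C gC el uv uv'|C' s C gC el] hN.
- have ND : GN N D by apply: hN; apply: mem_head.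
  have NC : GN N C by apply: hN; apply: (mem_last D [:: C]).
  exact: (@lift_sup D C D' C' t t' K b s' erefl erefl ND NC gD gC elD elC tt' ss' CD).
- have NC : GN N C by apply: hN; apply: mem_head.
  left; exact: (@lift_eqfact C C' u v v' erefl NC gC el uv uv').
- have NC : GN N C by apply: hN; apply: mem_head.
  left; exact: (@lift_eqres C C' s erefl NC gC el).
Qed.

End Lifting.

(** * Well-foundedness of strict subsumption *)

Section Subsumption.
Context (S : signature).
Implicit Types (t : term S) (sigma : subst S) (l : literal S) (C D : clause S).

Definition lweight l : nat := \sum_(t <- l.2) tweight t.
Definition cweight C : nat := \sum_(l <- C) lweight l.

Lemma sum_mmap (T U : choiceType) (f : T -> U) (F : U -> nat) (A : {mset T}) :
  \sum_(y <- mmap f A) F y = \sum_(x <- A) F (f x).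
Proof. by rewrite (perm_big _ (perm_eq_seq_mset _)) big_map. Qed.

Lemma tweight_tsubst sigma t :
  tweight (tsubst sigma t) = tweight t + \sum_(x <- tvars t) (tweight (sigma x)).-1.
Proof.
elim/term_mem_ind: t => [x|f ts IH] /=.
  by rewrite big_seq1 add1n prednK // tweight_gt0.
rewrite -addnA; congr addn; rewrite big_flatten big_map /=.
elim: ts IH => [|t ts IHts] IH; first by rewrite big_nil.
rewrite /= big_cons IH ?mem_head // IHts => [|u uts]; first lia.
by apply: IH; rewrite inE uts orbT.
Qed.

Lemma cweight_csubst sigma C :
  cweight (csubst sigma C) = cweight C + \sum_(x <- cvars C) (tweight (sigma x)).-1.
Proof.
rewrite /cweight sum_mmap /cvars big_flatten big_map -big_split /=.
apply: eq_bigr => l _; rewrite /lweight sum_mmap big_flatten big_map -big_split /=.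
by apply: eq_bigr => t _; apply: tweight_tsubst.
Qed.

Lemma cweightD C D : cweight (C `+` D) = cweight C + cweight D.
Proof. exact: mset_sumE. Qed.

Lemma cweight_eq0 C : wf_clause C -> cweight C = 0 -> C = mset0.
Proof.
move=> wC C0; have [//|[l lC]] := mset_0Vmem C; exfalso.
have [s [t [lE _ _ _]]] := wC _ lC.
move: C0; rewrite /cweight (big_rem l) //= {1}lE /lweight mset_sumE.
rewrite (enum_msetn 1 s) big_seq1; have := tweight_gt0 s; lia.
Qed.

Lemma size_tvars t : size (tvars t) <= tweight t.
Proof.
elim/term_mem_ind: t => //= f ts IH; rewrite size_flatten /shape.
elim: ts IH => //= t ts IHts IH; have := IH t (mem_head _ _).
have : forall u, u \in ts -> size (tvars u) <= tweight u.
  by move=> u uts; apply: IH; rewrite inE uts orbT.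
by move=> /IHts; lia.
Qed.

Lemma size_cvars C : size (cvars C) <= cweight C.
Proof.
rewrite /cvars size_flatten /shape sumnE !big_map; apply: leq_sum => l _.
rewrite size_flatten /shape sumnE !big_map; apply: leq_sum => t _.
exact: size_tvars.
Qed.

Definition nvars C : nat := size (undup (cvars C)).

Lemma nvars_le C : nvars C <= cweight C.
Proof. exact: leq_trans (size_undup _) (size_cvars C). Qed.

Lemma mem_cvars_csubst sigma C y : y \in cvars (csubst sigma C) ->
  exists2 x, x \in cvars C & y \in tvars (sigma x).
Proof.
move=> /mem_cvars[_ [_ [/mmapP[l lC ->] /mmapP[t tl ->] /mem_tvars_tsubst[x xt yx]]]].
by exists x => //; apply/mem_cvars; exists l, t.
Qed.

(** Weight 1 means that variables go to variables; since their number does not drop, [sigma] is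
    injective on the variables of [C] and can be inverted. *)
Lemma variant_subsumes sigma C : wt_subst sigma ->
  (forall x, x \in cvars C -> tweight (sigma x) = 1) ->
  nvars C <= nvars (csubst sigma C) -> subsumes (csubst sigma C) C.
Proof.
move=> wsig sig1 nv; pose rho (x : var S) := if sigma x is Var z then z else x.
have rhoE x : x \in cvars C -> sigma x = Var (rho x).
  by move/sig1; rewrite /rho; case: (sigma x).
have rho_ty x : x \in cvars C -> (rho x).1 = x.1.
  by move=> xC; have [_ <-] := wsig x; rewrite (rhoE _ xC).
set u := undup (cvars C); have uE x : (x \in u) = (x \in cvars C) by rewrite mem_undup.
(* A repetition would leave fewer distinct variables in the image than in [C]. *)
have uniq_ru : uniq (map rho u).
  rewrite -[uniq _]negbK -ltn_size_undup -leqNgt size_map; apply: leq_trans nv _.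
  apply: uniq_leq_size (undup_uniq _) _ => y; rewrite !mem_undup => /mem_cvars_csubst[x xC].
  by rewrite (rhoE _ xC) inE => /eqP ->; apply: map_f; rewrite uE.
pose tau (y : var S) := if y \in map rho u then Var (nth y u (index y (map rho u))) else Var y.
have tauE x : x \in cvars C -> tau (rho x) = Var x.
  rewrite -uE => xu; rewrite /tau map_f //.
  have iu : index x u < size u by rewrite index_mem.
  rewrite -{2}(nth_index x xu) -(nth_map x (rho x)) // index_uniq ?size_map //.
  by rewrite (set_nth_default x) // nth_index.
exists tau => [y|].
  rewrite /tau; case: ifP => [/mapP[x xu ->]|//]; split=> //=.
  rewrite uE in xu; have := tauE _ xu; rewrite /tau map_f ?uE // => -[->].
  by rewrite rho_ty.
rewrite csubst_comp (_ : csubst _ C = C) ?msubset_refl //.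
rewrite -[RHS]csubst_id; apply: eq_in_csubst => x xC.
by rewrite (rhoE _ xC) /= tauE.
Qed.

(** Codes a lexicographic order: the weight first, then more distinct variables count as smaller.
    The second summand is at most the weight [w], which is less than the gap [2w + 1] between
    consecutive squares. *)
Definition subsumption_measure C : nat := cweight C ^ 2 + (cweight C - nvars C).

(** At equal weight, [C] is the instance of [C'] with no further literals and only variables for
    variables; some variables must have been merged, or [C] would subsume [C']. *)
Lemma strictly_subsumes_measure C' C : wf_clause C -> strictly_subsumes C' C ->
  subsumption_measure C' < subsumption_measure C.
Proof.
move=> wC [[sigma wsig sub] nsub]; set B := C `\` csubst sigma C'.
have CE : C = csubst sigma C' `+` B by rewrite msetBDKC.
have wE : cweight C = cweight C' + \sum_(x <- cvars C') (tweight (sigma x)).-1 + cweight B.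
  by rewrite -cweight_csubst -cweightD -CE.
have [lt|ge] := ltnP (cweight C') (cweight C).
  rewrite /subsumption_measure; nia.
have B0 : B = mset0.
  apply: cweight_eq0; last lia.
  by move=> l lB; apply: wC; rewrite CE in_msetD lB orbT.
rewrite B0 msetD0 in CE.
have nv : nvars C < nvars C'.
  rewrite ltnNge; apply/negP => nv; apply: nsub; rewrite CE; apply: variant_subsumes => //.
    move=> x xC'; have : \sum_(x <- cvars C') (tweight (sigma x)).-1 = 0 by lia.
    move/eqP; rewrite sum_nat_seq_eq0 => /allP/(_ _ xC')/=.
    by have := tweight_gt0 (sigma x); lia.
  by rewrite -CE.
have := nvars_le C'; have := nvars_le C; rewrite /subsumption_measure.
have -> : cweight C' = cweight C by lia.
lia.
Qed.

End Subsumption.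

(** * Derivations and their limits *)

Section Limit.
Context (S : signature) (gt : term S -> term S -> Prop).
Hypothesis gt_simpl : simplification_order gt.
Context (N : nat -> clause_set S).
Hypothesis N_wf : forall i, wf_clause_set (N i).
Hypothesis N_derivation : is_derivation gt N.
Implicit Types (B C D E : clause S).
Local Notation ggt := (ggt gt).
Local Notation L := (limit N).

Lemma GN_ground (M : clause_set S) D : GN M D -> ground_clause D.
Proof. by case=> C _ []. Qed.

Lemma limit_wf : wf_clause_set L.
Proof. by move=> C [i /(_ i (leqnn i))]; apply: N_wf. Qed.

Lemma limit_or_deleted i C : N i C -> L C \/ exists j, N j C /\ ~ N j.+1 C.
Proof.
move=> NC; have [h|h] := classic (exists j, N j C /\ ~ N j.+1 C); [by right | left].
exists i => j; elim: j => [|j IH]; first by rewrite leqn0 => /eqP E; rewrite E in NC.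
rewrite leq_eqVlt => /orP[/eqP <- //|ij]; apply: NNPP => nN; apply: h.
by exists j; split=> //; apply: IH.
Qed.

(** Each redundant clause is replaced by the finitely many smaller limit instances that entail it,
    which stay below [B]. *)
Lemma entailed_below_trans (Ds : seq (clause S)) B E : ground_clause B ->
  (forall D, D \in Ds -> [/\ ground_clause D, cgt gt B D & GN L D \/ GRedCl gt (GN L) D]) ->
  entails (fun D => D \in Ds) E -> entailed_below gt (GN L) B E.
Proof.
move=> gB hDs ent.
have [Es EsP EsE] : exists2 Es : seq (clause S), (forall D, D \in Es -> GN L D /\ cgt gt B D) &
    forall D, D \in Ds -> entails (fun D => D \in Es) D.
  elim: Ds hDs {ent} => [|D Ds IH] hDs; first by exists [::].
  have [|Es EsP EsE] := IH; first by move=> D' D'Ds; apply: hDs; rewrite inE D'Ds orbT.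
  have [gD BD LD] := hDs D (mem_head _ _).
  have [Fs FsP FsE] : exists2 Fs : seq (clause S), (forall D, D \in Fs -> GN L D /\ cgt gt B D) &
      entails (fun D => D \in Fs) D.
    case: LD => [LD|[_ [Fs FsP FsE]]].
      by exists [:: D] => [D'|I]; [rewrite inE => /eqP -> | apply; rewrite mem_head].
    exists Fs => // F FFs; have [LF DF] := FsP _ FFs; split=> //.
    have gF := GN_ground LF; apply: cgt_ggt.
    exact: (cgt_trans gt_simpl (cgt_ground gB gD BD) (cgt_ground gD gF DF)).
  exists (Fs ++ Es) => [F|F]; first by rewrite mem_cat => /orP[/FsP|/EsP].
  rewrite inE => /orP[/eqP ->|FDs] I hI.
    by apply: FsE => F' F'Fs; apply: hI; rewrite mem_cat F'Fs.
  by apply: (EsE F FDs) => F' F'Es; apply: hI; rewrite mem_cat F'Es orbT.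
by exists Es => // I hI; apply: ent => D /EsE; apply.
Qed.

(** Stages only increase, so both inductions keep [i] general: redundancy leads to smaller ground
    clauses, subsumption to a clause of smaller measure with the same instance [D]. *)
Lemma instance_limit D : forall i C, N i C -> G C D -> GN L D \/ GRedCl gt (GN L) D.
Proof.
elim/(well_founded_induction (cgt_wf gt_simpl)): D => D IH i C.
have [n] := ubnP (subsumption_measure C); elim: n => // n IHn in i C *.
move=> mC NC GCD; have [LC|[j [NjC nNjC]]] := limit_or_deleted NC; first by left; exists C.
have [wC redC] := N_derivation NjC nNjC.
case: (redC _ GCD) => [[gD [Ds DsP ent]]|[C' [NC' GC'D subC']]]; last first.
  apply: (IHn j.+1 C') => //; have := strictly_subsumes_measure wC subC'; lia.
right; split=> //; apply: (@entailed_below_trans Ds) => // F FDs.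
have [NF DF] := DsP _ FDs; have gF := GN_ground NF; split=> //.
case: NF => C2 NC2 GC2; apply: IH NC2 GC2; exact: cgt_ground.
Qed.

Lemma entailed_below_limit i B E : ground_clause B ->
  entailed_below gt (GN (N i)) B E -> entailed_below gt (GN L) B E.
Proof.
move=> gB [Ds DsP]; apply: entailed_below_trans => // D /DsP[ND BD].
split=> //; first exact: GN_ground ND.
by case: ND => C NC GC; apply: instance_limit NC GC.
Qed.

End Limit.

(** * Completeness of fair derivations *)

Theorem theorem2 (S : signature)
    (ty_inhabited : forall tau : ty S,
       exists2 t : term S, ground_term t & ty_of t = tau)
    (gt : term S -> term S -> Prop) (gt_simpl : simplification_order gt)
    (sel : selection S) (sel_fun : selection_function sel)
    (N : nat -> clause_set S)
    (N_wf : forall i, wf_clause_set (N i))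
    (N_derivation : is_derivation gt N)
    (N_fair : fair gt sel N)
    (N0_unsat : entails (N 0) (bot S)) :
  exists i, N i (bot S).
Proof.
apply: NNPP => no_bot; set L := limit N; have L_wf : wf_clause_set L := limit_wf N_wf.
have ground_bot : ground_clause (bot S) by apply/ground_clauseP => l; rewrite in_mset0.
have [rep repP] : exists rep : clause S -> clause S * subst S, forall C, ground_clause C ->
    [/\ wf_clause (rep C).1, wt_subst (rep C).2, C = csubst (rep C).2 (rep C).1
      & GN L C -> L (rep C).1 /\ ground_subst (rep C).2].
  apply: (choice (fun C (p : clause S * subst S) => ground_clause C ->
    [/\ wf_clause p.1, wt_subst p.2, C = csubst p.2 p.1
      & GN L C -> L p.1 /\ ground_subst p.2])) => C.
  have [[D LD GDC]|nC] := classic (GN L C).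
    have [theta gth CE] := ground_instance ty_inhabited GDC.
    by exists (D, theta) => _; split=> //; [exact: L_wf | exact: ground_subst_wt].
  (* [Gsel] asks for a representation of every ground clause; those that are not instances of the
     limit represent themselves. *)
  exists (C, @id_subst S) => -[wC _]; split=> //.
  by rewrite /= id_csubst.
pose gsel : selection S := fun C => sel_subst (rep C).2 (sel (rep C).1).
have gselP : Gsel sel gsel.
  split=> [C gC l|C gC].
    have [wD _ CE _] := repP C gC.
    move=> /sel_substP[l0 /(sel_fun _ wD)[l0D l01] ->]; split=> //.
    by rewrite [X in _ \in X]CE; apply: mem_mmap.
  by have [wD wth CE _] := repP C gC; exists (rep C).1, (rep C).2.
have rep_inst C : GN L C ->
    [/\ L (rep C).1, ground_subst (rep C).2 & csubst (rep C).2 (rep C).1 = C].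
  by move=> LC; have [_ _ CE /(_ LC)[]] := repP C (GN_ground LC).
have saturated : ground_saturated gt gsel (GN L).
  move=> ig hig hL; case: (lifting gt_simpl sel_fun L_wf rep_inst hig hL); last by right.
  move=> [i [iInf iL iGI]]; have [n [_ red]] := N_fair _ iInf iL.
  case: (red _ gselP _ iGI) => _ [[C Cig [gC redC]]|below]; [left | right].
    by exists C => //; split=> //; apply: entailed_below_limit redC.
  apply: entailed_below_limit below => //.
  (* The maximal premise is a premise or the default [bot S] of [last], and both are ground. *)
  have := mem_last (bot S) (gprems ig); rewrite inE => /orP[/eqP|/hL/GN_ground //].
  by rewrite /max_prem => ->.
have L_bot : ~ GN L (bot S).
  move=> [C [i NC] [_ [theta _ CE]]]; apply: no_bot; exists i.
  suff <- : C = bot S by apply: NC.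
  have [//|[l lC]] := mset_0Vmem C.
  by have := mem_mmap (lsubst theta) lC; rewrite -/(csubst theta C) -CE in_mset0.
have [R Rdec RL] := ground_completeness gt_simpl ty_inhabited (proj1 gselP)
  (@GN_ground S L) L_bot saturated.
have mods C : N 0 C -> models (term_model gt_simpl ty_inhabited Rdec) C.
  move=> NC; apply: models_instances; first exact: N_wf NC.
  move=> theta gth.
  have GC : G C (csubst theta C) by apply: ground_subst_G => //; apply: N_wf NC.
  case: (instance_limit gt_simpl N_derivation NC GC) => [/RL //|[gC [Ds DsP ent]]].
  apply: (entailed_true ty_inhabited Rdec ent) => // D /DsP[LD _].
  by split; [exact: GN_ground LD | exact: RL].
have [v hv] := term_model_valuation gt_simpl ty_inhabited Rdec.
by have [l] := N0_unsat _ mods v hv; rewrite in_mset0.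
Qed.
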